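(* Let $k$ be an algebraically closed field of characteristic $0$ and let $H$ be a finite dimensional non-cosemisimple Hopf algebra over $k$ with no nontrivial skew primitive elements. Suppose that, as coalgebras, $H_0 \cong k[G] \oplus \mathcal{M}^c(n_1,k) \oplus \cdots \oplus \mathcal{M}^c(n_t,k)$, where $G=G(H)$, $t\geq 1$ and $2 \leq n_1 \leq n_2 \leq \cdots \leq n_t$. Then $\dim P_1$ is a multiple of $|G|$ and $\dim P_1 \geq \min(n_1^2,\, 2n_1|G|)$.
   Context: $G(H)$ is the group of grouplike elements of $H$. $H_0$ is the coradical of $H$ and $H_0\subseteq H_1\subseteq\cdots$ is the coradical filtration. $\mathcal{M}^c(n,k)$ is the $n\times n$ matrix coalgebra: it has a basis $\{e_{ij}\mid 1\le i,j\le n\}$ with $\Delta(e_{ij})=\sum_{r=1}^n e_{ir}\otimes e_{rj}$ and $\epsilon(e_{ij})=\delta_{ij}$. A skew primitive element is an $x\in H$ with $\Delta(x)=g\otimes x+x\otimes h$ for some $g,h\in G(H)$; it is nontrivial if $x\notin k[G(H)]$. Definition of $P_1$: over an algebraically closed field there is a coalgebra projection $\pi:H\to H_0$ (a coalgebra map restricting to the identity on $H_0$); fix one, with kernel $I$. Put $\rho_L=(\pi\otimes \mathrm{id})\Delta:H\to H_0\otimes H$ and $\rho_R=(\mathrm{id}\otimes\pi)\Delta:H\to H\otimes H_0$, and let $$P_1=\{x\in H:\Delta(x)=\rho_L(x)+\rho_R(x)\}=\Delta^{-1}(H_0\otimes I+I\otimes H_0).$$ One has $P_1=H_1\cap I$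 and $H_1=H_0\oplus P_1$. *)

(* Defs.v *)
From HB Require Import structures.
From mathcomp Require Import all_boot all_order all_algebra falgebra.
From mathcomp Require Import finmap boolp classical_sets functions cardinality.

Set Implicit Arguments.
Unset Strict Implicit.
Unset Printing Implicit Defensive.

Import GRing.Theory.
Local Open Scope ring_scope.

(* The tensor product of two finite dimensional spaces, in coordinates with
   respect to the bases [vbasis {:V}] and [vbasis {:W}].  [tlift] and [tliftE]
   express its universal property. *)
Section Tensor.

Variables (k : fieldType) (V W : vectType k).

Definition tensor : vectType k := 'M[k]_(\dim {:V}, \dim {:W}).

Definition pure (v : V) (w : W) : tensor :=
  \matrix_(i, j) (coord (vbasis {:V}) i v * coord (vbasis {:W}) j w).

(* When [b] is bilinear, this is the linear map sending [pure v w] to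
   [b v w]. *)
Definition tlift (U : lmodType k) (b : V -> W -> U) (t : tensor) : U :=
  \sum_i \sum_j (t : 'M_(_, _)) i j *: b (vbasis {:V})`_i (vbasis {:W})`_j.

Fact tlift_is_linear (U : lmodType k) (b : V -> W -> U) : linear (tlift b).
Proof.
move=> a s t; rewrite /tlift scaler_sumr -big_split; apply: eq_bigr => i _.
rewrite scaler_sumr -big_split; apply: eq_bigr => j _ /=.
by rewrite !mxE scalerDl scalerA.
Qed.

HB.instance Definition _ (U : lmodType k) (b : V -> W -> U) :=
  GRing.isLinear.Build k tensor U _ (tlift b) (tlift_is_linear b).

Lemma tliftE (U : lmodType k) (b : V -> W -> U) v w :
  (forall y, linear (b^~ y)) -> (forall x, linear (b x)) ->
  tlift b (pure v w) = b v w.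
Proof.
move=> bl br.
pose bL y : {linear V -> U} :=
  HB.pack (b^~ y) (GRing.isLinear.Build k V U _ (b^~ y) (bl y)).
pose bR x : {linear W -> U} :=
  HB.pack (b x) (GRing.isLinear.Build k W U _ (b x) (br x)).
have bLE y x : b x y =
    \sum_i coord (vbasis {:V}) i x *: b (vbasis {:V})`_i y.
  rewrite -[LHS]/(bL y x) {1}(coord_vbasis (memvf x)) linear_sum.
  by apply: eq_bigr => i _; rewrite linearZ.
have bRE x y : b x y =
    \sum_j coord (vbasis {:W}) j y *: b x (vbasis {:W})`_j.
  rewrite -[LHS]/(bR x y) {1}(coord_vbasis (memvf y)) linear_sum.
  by apply: eq_bigr => j _; rewrite linearZ.
rewrite [RHS]bLE; apply: eq_bigr => i _; rewrite [in RHS]bRE scaler_sumr.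
by apply: eq_bigr => j _; rewrite mxE scalerA.
Qed.

Lemma pure_linearl w : linear (pure^~ w).
Proof. by move=> a u v; apply/matrixP=> i j; rewrite !mxE linearP mulrDl mulrA. Qed.

Lemma pure_linearr v : linear (pure v).
Proof.
by move=> a u w; apply/matrixP=> i j; rewrite !mxE linearP mulrDr mulrCA.
Qed.

Lemma pure_suml w I r (P : pred I) F :
  pure (\sum_(i <- r | P i) F i) w = \sum_(i <- r | P i) pure (F i) w.
Proof.
apply: (big_morph (pure^~ w)) => [x y|].
  by have := pure_linearl w 1 x y; rewrite !scale1r.
by apply/matrixP=> i j; rewrite !mxE linear0 mul0r.
Qed.

Lemma pure_sumr v I r (P : pred I) F :
  pure v (\sum_(i <- r | P i) F i) = \sum_(i <- r | P i) pure v (F i).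
Proof.
apply: (big_morph (pure v)) => [x y|].
  by have := pure_linearr v 1 x y; rewrite !scale1r.
by apply/matrixP=> i j; rewrite !mxE linear0 mulr0.
Qed.

Lemma pureZl a v w : pure (a *: v) w = a *: pure v w.
Proof. by apply/matrixP=> i j; rewrite !mxE linearZ mulrA. Qed.

Lemma pureZr a v w : pure v (a *: w) = a *: pure v w.
Proof. by apply/matrixP=> i j; rewrite !mxE linearZ mulrCA. Qed.

Lemma tensor_sum (t : tensor) :
  t = \sum_i \sum_j
    (t : 'M_(_, _)) i j *: pure (vbasis {:V})`_i (vbasis {:W})`_j.
Proof.
have fr (U : vectType k) : free (vbasis {:U}) by apply/basis_free/vbasisP.
have tE i' j' i j : (t i' j' *: pure (vbasis {:V})`_i' (vbasis {:W})`_j') i j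
    = t i' j' * ((i' == i)%:R * (j' == j)%:R).
  by rewrite !mxE !coord_free.
apply/matrixP=> i j; rewrite summxE (bigD1 i) //= summxE (bigD1 j) //= tE.
rewrite !eqxx !mulr1 !big1 ?addr0 // => [i' /negPf ni|j' /negPf nj].
  by rewrite summxE big1 // => j' _; rewrite tE ni mul0r mulr0.
by rewrite tE nj !mulr0.
Qed.

Lemma tensor_ext (U : lmodType k) (f g : {linear tensor -> U}) :
  (forall v w, f (pure v w) = g (pure v w)) -> f =1 g.
Proof.
move=> fg t; rewrite [t]tensor_sum !linear_sum; apply: eq_bigr => i _.
by rewrite !linear_sum; apply: eq_bigr => j _; rewrite !linearZ /= fg.
Qed.

End Tensor.

Notation "v ⊗ w" := (pure v w) (at level 40, left associativity) : ring_scope.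

Lemma tlift_scalel (k : fieldType) (V W : vectType k) (l : {scalar V}) v
  (w : W) : tlift (fun x y => l x *: y) (v ⊗ w) = l v *: w.
Proof.
rewrite tliftE // => [y|x] a p q; first by rewrite linearP scalerDl scalerA.
by rewrite scalerDr !scalerA mulrC.
Qed.

Lemma tlift_scaler (k : fieldType) (V W : vectType k) (l : {scalar W}) (v : V)
  w : tlift (fun x y => l y *: x) (v ⊗ w) = l w *: v.
Proof.
rewrite tliftE // => [y|x] a p q; last by rewrite linearP scalerDl scalerA.
by rewrite scalerDr !scalerA mulrC.
Qed.

Section TensorMap.

Variable k : fieldType.

Definition tmap (V V' W W' : vectType k) (f : 'Hom(V, V')) (g : 'Hom(W, W')) :
    'Hom(tensor V W, tensor V' W') :=
  linfun (tlift (fun v w => f v ⊗ g w)).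

Definition tassoc (U V W : vectType k) :
    'Hom(tensor (tensor U V) W, tensor U (tensor V W)) :=
  linfun (tlift (fun t w => tlift (fun u v => u ⊗ (v ⊗ w)) t)).

Lemma tmapE (V V' W W' : vectType k) (f : 'Hom(V, V')) (g : 'Hom(W, W')) v w :
  tmap f g (v ⊗ w) = f v ⊗ g w.
Proof.
rewrite lfunE /= tliftE // => [y|x] a u u'; rewrite linearP.
  exact: pure_linearl.
exact: pure_linearr.
Qed.

Lemma tassocE (U V W : vectType k) (u : U) (v : V) (w : W) :
  tassoc U V W ((u ⊗ v) ⊗ w) = u ⊗ (v ⊗ w).
Proof.
rewrite lfunE /= tliftE.
- by rewrite tliftE // => [y|x] a z z'; rewrite ?pure_linearl ?pure_linearr.
- by move=> y a z z'; rewrite linearP.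
move=> x a z z'; rewrite /tlift scaler_sumr -big_split; apply: eq_bigr => i _.
rewrite scaler_sumr -big_split; apply: eq_bigr => j _ /=.
by rewrite !pure_linearr scalerDr !scalerA mulrC.
Qed.

Lemma tmap_comp (V V' V'' W W' W'' : vectType k) (f : 'Hom(V', V''))
    (f' : 'Hom(V, V')) (g : 'Hom(W', W'')) (g' : 'Hom(W, W')) t :
  tmap f g (tmap f' g' t) = tmap (f \o f')%VF (g \o g')%VF t.
Proof.
rewrite -comp_lfunE; apply: tensor_ext => v w /=.
by rewrite comp_lfunE !tmapE !comp_lfunE.
Qed.

Lemma tassoc_nat (U U' V V' W W' : vectType k) (f : 'Hom(U, U'))
    (g : 'Hom(V, V')) (h : 'Hom(W, W')) t :
  tassoc U' V' W' (tmap (tmap f g) h t) = tmap f (tmap g h) (tassoc U V W t).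
Proof.
rewrite -!comp_lfunE; apply: tensor_ext => s w /=; rewrite !comp_lfunE tmapE.
rewrite [s]tensor_sum !linear_sum /= !pure_suml !linear_sum; apply: eq_bigr => i _.
rewrite !linear_sum /= !pure_suml !linear_sum; apply: eq_bigr => j _.
by rewrite !linearZ /= !pureZl !linearZ /= tmapE !tassocE !tmapE.
Qed.

(* The image of [tensor U W] in [tensor V V']. *)
Definition tensorv (V V' : vectType k) (U : {vspace V}) (W : {vspace V'}) :
    {vspace tensor V V'} :=
  <<[seq u ⊗ w | u <- vbasis U, w <- vbasis W]>>%VS.

Lemma mem_tensorv (V V' : vectType k) (U : {vspace V}) (W : {vspace V'}) u w :
  u \in U -> w \in W -> u ⊗ w \in tensorv U W.
Proof.
move=> Uu Ww; rewrite (coord_vbasis Uu) (coord_vbasis Ww) pure_suml.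
apply: memv_suml => i _; rewrite pure_sumr; apply: memv_suml => j _.
rewrite pureZl pureZr; do 2!apply: memvZ; apply/memv_span.
by apply: allpairs_f; rewrite mem_nth ?size_tuple.
Qed.

End TensorMap.

Record coalgebra (k : fieldType) (V : vectType k) := Coalgebra {
  comul : 'Hom(V, tensor V V);
  counit : {scalar V};
  comulA : forall x,
    tassoc V V V (tmap comul \1%VF (comul x)) = tmap \1%VF comul (comul x);
  counitl : forall x, tlift (fun u v => counit u *: v) (comul x) = x;
  counitr : forall x, tlift (fun u v => counit v *: u) (comul x) = x
}.

(* (a ⊗ b)(c ⊗ d) = ac ⊗ bd, see [tmulE]. *)
Definition tmul (k : fieldType) (A : falgType k) (s t : tensor A A) :
    tensor A A :=
  tlift (fun a b => tlift (fun c d => (a * c) ⊗ (b * d)) t) s.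

Lemma tmulE (k : fieldType) (A : falgType k) (a b c d : A) :
  tmul (a ⊗ b) (c ⊗ d) = (a * c) ⊗ (b * d).
Proof.
rewrite /tmul tliftE.
- rewrite tliftE // => [y|x] r z z'; rewrite mulrDr -scalerAr.
    exact: pure_linearl.
  exact: pure_linearr.
- move=> y r z z'; rewrite /tlift scaler_sumr -big_split; apply: eq_bigr => i _ /=.
  rewrite scaler_sumr -big_split; apply: eq_bigr => j _ /=.
  by rewrite mulrDl -scalerAl pure_linearl scalerDr !scalerA mulrC.
move=> x r z z'; rewrite /tlift scaler_sumr -big_split; apply: eq_bigr => i _ /=.
rewrite scaler_sumr -big_split; apply: eq_bigr => j _ /=.
by rewrite mulrDl -scalerAl pure_linearr scalerDr !scalerA mulrC.
Qed.

Record hopf_algebra (k : fieldType) (H : falgType k) := HopfAlgebra {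
  hopf_coalgebra :> coalgebra H;
  antipode : 'End(H);
  comul1 : comul hopf_coalgebra 1 = 1 ⊗ 1;
  comulM : forall x y : H, comul hopf_coalgebra (x * y)
    = tmul (comul hopf_coalgebra x) (comul hopf_coalgebra y);
  counit1 : counit hopf_coalgebra 1 = 1;
  counitM : forall x y : H, counit hopf_coalgebra (x * y)
    = counit hopf_coalgebra x * counit hopf_coalgebra y;
  antipodel : forall x : H,
    tlift (fun u v => antipode u * v) (comul hopf_coalgebra x)
    = counit hopf_coalgebra x *: 1;
  antipoder : forall x : H,
    tlift (fun u v => u * antipode v) (comul hopf_coalgebra x)
    = counit hopf_coalgebra x *: 1
}.

(* The coalgebra k[T] on a finite set T, all of whose elements are
   grouplike. *)
Section GrouplikeCoalgebra.

Variables (k : fieldType) (T : finType).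

Definition glspace : vectType k := {ffun T -> k^o}.

Local Notation C := glspace.

Definition glelt (t : T) : C := [ffun s => (s == t)%:R].

Definition glcomul (f : C) : tensor C C := \sum_t f t *: (glelt t ⊗ glelt t).

Definition glcounit (f : C) : k := \sum_t f t.

Fact glcomul_linear : linear glcomul.
Proof.
move=> a f g; rewrite /glcomul scaler_sumr -big_split; apply: eq_bigr => t _.
by rewrite !ffunE scalerDl scalerA.
Qed.

HB.instance Definition _ := GRing.isLinear.Build k C _ _ glcomul glcomul_linear.

Fact glcounit_linear : scalar glcounit.
Proof.
move=> a f g; rewrite /glcounit mulr_sumr -big_split; apply: eq_bigr => t _.
by rewrite !ffunE.
Qed.

HB.instance Definition _ :=
  GRing.isLinear.Build k C k *%R glcounit glcounit_linear.

Lemma glcoalg_sum (f : C) : f = \sum_t (f t : k) *: glelt t.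
Proof.
apply/ffunP=> s; rewrite sum_ffunE (bigD1 s) //= !ffunE eqxx.
rewrite [_ *: _]mulr1 big1 ?addr0 // => t /negPf nt.
by rewrite !ffunE eq_sym nt [_ *: _]mulr0.
Qed.

Lemma glcoalg_ext (U : lmodType k) (f g : {linear C -> U}) :
  (forall t, f (glelt t) = g (glelt t)) -> f =1 g.
Proof.
move=> fg x; rewrite [x]glcoalg_sum !linear_sum; apply: eq_bigr => t _.
by rewrite !linearZ /= fg.
Qed.

Lemma glcomulE t : glcomul (glelt t) = glelt t ⊗ glelt t.
Proof.
rewrite /glcomul (bigD1 t) //= ffunE eqxx scale1r big1 ?addr0 // => s /negPf ns.
by rewrite ffunE ns scale0r.
Qed.

Lemma glcounitE t : glcounit (glelt t) = 1.
Proof.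
rewrite /glcounit (bigD1 t) //= ffunE eqxx big1 ?addr0 // => s /negPf ns.
by rewrite ffunE ns.
Qed.

Let comul := linfun glcomul.

Fact glcomulA x :
  tassoc C C C (tmap comul \1%VF (comul x)) = tmap \1%VF comul (comul x).
Proof.
have cE t : comul (glelt t) = glelt t ⊗ glelt t by rewrite lfunE /= glcomulE.
pose f := (tassoc C C C \o (tmap comul \1 \o comul))%VF.
pose g := (tmap \1 comul \o comul)%VF.
suff: f =1 g by move/(_ x); rewrite /f /g /= !comp_lfunE.
apply: glcoalg_ext => t; rewrite /f /g /= !comp_lfunE.
by rewrite !cE !tmapE id_lfunE cE tassocE.
Qed.

Fact glcounitl x : tlift (fun u v => glcounit u *: v) (comul x) = x.
Proof.
rewrite lfunE -[LHS]/((tlift _ \o glcomul) x) -[RHS]/(idfun x).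
by apply: glcoalg_ext => t /=; rewrite glcomulE tlift_scalel /= glcounitE scale1r.
Qed.

Fact glcounitr x : tlift (fun u v => glcounit v *: u) (comul x) = x.
Proof.
rewrite lfunE -[LHS]/((tlift _ \o glcomul) x) -[RHS]/(idfun x).
by apply: glcoalg_ext => t /=; rewrite glcomulE tlift_scaler /= glcounitE scale1r.
Qed.

Definition glcoalg : coalgebra glspace :=
  Coalgebra glcomulA glcounitl glcounitr.

End GrouplikeCoalgebra.

(* The matrix coalgebra, where [delta_mx i j] is the basis vector e_ij. *)
Section MatrixCoalgebra.

Variables (k : fieldType) (n : nat).
Definition mxspace : vectType k := 'M[k]_n.

Local Notation C := mxspace.
Local Notation e i j := (delta_mx i j : mxspace).

Definition mxcomul (A : C) : tensor C C :=
  \sum_i \sum_j A i j *: \sum_r e i r ⊗ e r j.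

Definition mxcounit (A : C) : k := \sum_i \sum_j A i j * (i == j)%:R.

Fact mxcomul_linear : linear mxcomul.
Proof.
move=> a A B; rewrite /mxcomul scaler_sumr -big_split; apply: eq_bigr => i _.
rewrite scaler_sumr -big_split; apply: eq_bigr => j _ /=.
by rewrite !mxE scalerDl scalerA.
Qed.

HB.instance Definition _ := GRing.isLinear.Build k C _ _ mxcomul mxcomul_linear.

Fact mxcounit_linear : scalar mxcounit.
Proof.
move=> a A B; rewrite /mxcounit mulr_sumr -big_split; apply: eq_bigr => i _.
rewrite mulr_sumr -big_split; apply: eq_bigr => j _ /=.
by rewrite !mxE mulrDl -mulrA.
Qed.

HB.instance Definition _ :=
  GRing.isLinear.Build k C k *%R mxcounit mxcounit_linear.

Lemma matcoalg_ext (U : lmodType k) (f g : {linear C -> U}) :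
  (forall i j, f (e i j) = g (e i j)) -> f =1 g.
Proof.
move=> fg x; rewrite [x]matrix_sum_delta !linear_sum; apply: eq_bigr => i _.
rewrite !linear_sum; apply: eq_bigr => j _.
by rewrite !linearZ /= fg.
Qed.

Lemma mxcomulE i j : mxcomul (e i j) = \sum_r e i r ⊗ e r j.
Proof.
rewrite /mxcomul (bigD1 i) //= [X in _ + X]big1 => [|p /negPf np]; last first.
  by rewrite big1 // => q _; rewrite mxE np scale0r.
rewrite addr0 (bigD1 j) //= mxE !eqxx scale1r [X in _ + X]big1 ?addr0 // => q /negPf nq.
by rewrite mxE nq andbF scale0r.
Qed.

Lemma mxcounitE i j : mxcounit (e i j) = (i == j)%:R.
Proof.
rewrite /mxcounit (bigD1 i) //= (bigD1 j) //= mxE !eqxx mul1r.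
rewrite !big1 ?addr0 // => [p /negPf np|q /negPf nq].
  by rewrite big1 // => q _; rewrite mxE np mul0r.
by rewrite mxE nq andbF mul0r.
Qed.

Let comul := linfun mxcomul.

Fact mxcomulA x :
  tassoc C C C (tmap comul \1%VF (comul x)) = tmap \1%VF comul (comul x).
Proof.
have cE i j : comul (e i j) = \sum_r e i r ⊗ e r j.
  by rewrite lfunE /= mxcomulE.
pose f := (tassoc C C C \o (tmap comul \1 \o comul))%VF.
pose g := (tmap \1 comul \o comul)%VF.
suff: f =1 g by move/(_ x); rewrite /f /g /= !comp_lfunE.
apply: matcoalg_ext => i j; rewrite /f /g /= !comp_lfunE.
rewrite !cE !linear_sum /=.
under eq_bigr => r _ do rewrite tmapE id_lfunE cE pure_suml linear_sum.
under [RHS]eq_bigr => r _ do rewrite tmapE id_lfunE cE pure_sumr.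
rewrite exchange_big /=; apply: eq_bigr => r _; apply: eq_bigr => s _.
by rewrite tassocE.
Qed.

Fact mxcounitl x : tlift (fun u v => mxcounit u *: v) (comul x) = x.
Proof.
rewrite lfunE -[LHS]/((tlift _ \o mxcomul) x) -[RHS]/(idfun x).
apply: matcoalg_ext => i j /=; rewrite mxcomulE linear_sum (bigD1 i) //=.
rewrite tlift_scalel /= mxcounitE eqxx scale1r big1 ?addr0 // => r /negPf nr.
by rewrite tlift_scalel /= mxcounitE eq_sym nr scale0r.
Qed.

Fact mxcounitr x : tlift (fun u v => mxcounit v *: u) (comul x) = x.
Proof.
rewrite lfunE -[LHS]/((tlift _ \o mxcomul) x) -[RHS]/(idfun x).
apply: matcoalg_ext => i j /=; rewrite mxcomulE linear_sum (bigD1 j) //=.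
rewrite tlift_scaler /= mxcounitE eqxx scale1r big1 ?addr0 // => r /negPf nr.
by rewrite tlift_scaler /= mxcounitE nr scale0r.
Qed.

Definition matcoalg : coalgebra mxspace :=
  Coalgebra mxcomulA mxcounitl mxcounitr.

End MatrixCoalgebra.

Section DirectSum.

Variables (k : fieldType) (V W : vectType k).
Variables (c : coalgebra V) (d : coalgebra W).

Definition dsum_space : vectType k := (V * W)%type.

Local Notation E := dsum_space.

Definition dsum_inl (x : V) : E := (x, 0).
Definition dsum_inr (y : W) : E := (0, y).

Fact dsum_inl_linear : linear dsum_inl.
Proof.
by move=> a x y; apply/pair_eqP; rewrite /pair_eq /= scaler0 addr0 !eqxx.
Qed.

Fact dsum_inr_linear : linear dsum_inr.
Proof.
by move=> a x y; apply/pair_eqP; rewrite /pair_eq /= scaler0 addr0 !eqxx.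
Qed.

HB.instance Definition _ := GRing.isLinear.Build k V E _ dsum_inl dsum_inl_linear.
HB.instance Definition _ := GRing.isLinear.Build k W E _ dsum_inr dsum_inr_linear.

Definition inl_lfun : 'Hom(V, E) := linfun dsum_inl.
Definition inr_lfun : 'Hom(W, E) := linfun dsum_inr.

Lemma inl_inr (z : E) : z = inl_lfun z.1 + inr_lfun z.2.
Proof.
by rewrite !lfunE /=; case: z => x y; congr pair; rewrite /= ?addr0 ?add0r.
Qed.

Definition dsum_comul (z : E) : tensor E E :=
  tmap inl_lfun inl_lfun (comul c z.1) + tmap inr_lfun inr_lfun (comul d z.2).

Definition dsum_counit (z : E) : k := counit c z.1 + counit d z.2.

Fact dsum_comul_linear : linear dsum_comul.
Proof.
by move=> a x y; rewrite /dsum_comul /= !linearP /= scalerDr addrACA.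
Qed.

HB.instance Definition _ :=
  GRing.isLinear.Build k E _ _ dsum_comul dsum_comul_linear.

Fact dsum_counit_linear : scalar dsum_counit.
Proof.
by move=> a x y; rewrite /dsum_counit /= !linearP /= mulrDr addrACA.
Qed.

HB.instance Definition _ :=
  GRing.isLinear.Build k E k *%R dsum_counit dsum_counit_linear.

Let comulE := linfun dsum_comul.

Let comul_inl v : comulE (inl_lfun v) = tmap inl_lfun inl_lfun (comul c v).
Proof.
by rewrite [LHS]lfunE /= /dsum_comul [inl_lfun v]lfunE /= !linear0 addr0.
Qed.

Let comul_inr v : comulE (inr_lfun v) = tmap inr_lfun inr_lfun (comul d v).
Proof.
by rewrite [LHS]lfunE /= /dsum_comul [inr_lfun v]lfunE /= !linear0 add0r.
Qed.

Let counit_inl v : dsum_counit (inl_lfun v) = counit c v.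
Proof. by rewrite /dsum_counit lfunE /= linear0 addr0. Qed.

Let counit_inr v : dsum_counit (inr_lfun v) = counit d v.
Proof. by rewrite /dsum_counit lfunE /= linear0 add0r. Qed.

Fact dsum_comulA z :
  tassoc E E E (tmap comulE \1%VF (comulE z)) = tmap \1%VF comulE (comulE z).
Proof.
have pushA (U : vectType k) (b : coalgebra U) (f : 'Hom(U, E)) u :
    (forall u, comulE (f u) = tmap f f (comul b u)) ->
  tassoc E E E (tmap comulE \1%VF (comulE (f u)))
    = tmap \1%VF comulE (comulE (f u)).
  move=> cf; have cfE : (comulE \o f)%VF = (tmap f f \o comul b)%VF.
    by apply/lfunP=> x; rewrite !comp_lfunE cf.
  rewrite cf !tmap_comp !cfE !comp_lfun1l.
  have -> t : tmap (tmap f f \o comul b)%VF f t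
      = tmap (tmap f f) f (tmap (comul b) \1%VF t).
    by rewrite tmap_comp comp_lfun1r.
  have -> t : tmap f (tmap f f \o comul b)%VF t
      = tmap f (tmap f f) (tmap \1%VF (comul b) t).
    by rewrite tmap_comp comp_lfun1r.
  by rewrite tassoc_nat comulA.
by rewrite [z]inl_inr !linearD /= (pushA _ c) // (pushA _ d).
Qed.

Fact dsum_counitl z : tlift (fun u v => dsum_counit u *: v) (comulE z) = z.
Proof.
have push (U : vectType k) (b : coalgebra U) (f : 'Hom(U, E)) u :
    (forall u, dsum_counit (f u) = counit b u) ->
  tlift (fun u v => dsum_counit u *: v) (tmap f f (comul b u)) = f u.
  move=> cf; rewrite -{2}[u](counitl b); set t := comul b u.
  rewrite -[LHS]/((_ \o _) t) -[RHS]/((_ \o _) t); apply: tensor_ext => x y /=.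
  by rewrite tmapE !tlift_scalel linearZ /= cf.
by rewrite {2}[z]inl_inr lfunE linearD /= (push _ c) ?(push _ d).
Qed.

Fact dsum_counitr z : tlift (fun u v => dsum_counit v *: u) (comulE z) = z.
Proof.
have push (U : vectType k) (b : coalgebra U) (f : 'Hom(U, E)) u :
    (forall u, dsum_counit (f u) = counit b u) ->
  tlift (fun u v => dsum_counit v *: u) (tmap f f (comul b u)) = f u.
  move=> cf; rewrite -{2}[u](counitr b); set t := comul b u.
  rewrite -[LHS]/((_ \o _) t) -[RHS]/((_ \o _) t); apply: tensor_ext => x y /=.
  by rewrite tmapE !tlift_scaler linearZ /= cf.
by rewrite {2}[z]inl_inr lfunE linearD /= (push _ c) ?(push _ d).
Qed.

Definition dsum : coalgebra dsum_space :=
  Coalgebra dsum_comulA dsum_counitl dsum_counitr.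

End DirectSum.

(* For [ns = [:: n_1; ...; n_t]], the coalgebra
   V ⊕ M^c(n_1, k) ⊕ ... ⊕ M^c(n_t, k). *)
Fixpoint dsum_mx_space (k : fieldType) (V : vectType k) (ns : seq nat) :
    vectType k :=
  if ns is n :: ns' then dsum_mx_space (dsum_space V (mxspace k n)) ns' else V.

Fixpoint dsum_mx (k : fieldType) (V : vectType k) (c : coalgebra V)
    (ns : seq nat) : coalgebra (dsum_mx_space V ns) :=
  if ns is n :: ns' then dsum_mx (dsum c (matcoalg k n)) ns' else c.

Definition coalg_morph (k : fieldType) (V W : vectType k)
    (c : coalgebra V) (d : coalgebra W) (f : 'Hom(V, W)) : Prop :=
  (forall x, comul d (f x) = tmap f f (comul c x)) /\
  (forall x, counit d (f x) = counit c x).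

Section CoalgebraTheory.

Variables (k : fieldType) (V : vectType k) (c : coalgebra V).
Implicit Types (U C : {vspace V}) (x g h : V).

Definition subcoalgebra C := (comul c @: C <= tensorv C C)%VS.

Definition simple_subcoalgebra C : Prop :=
  [/\ subcoalgebra C, C <> 0%VS &
      forall D : {vspace V}, subcoalgebra D -> (D <= C)%VS ->
        D = 0%VS \/ D = C].

(* [U] is the sum of the subspaces satisfying [P]. *)
Definition is_vsum (P : {vspace V} -> Prop) U : Prop :=
  (forall C, P C -> (C <= U)%VS) /\
  (forall D : {vspace V}, (forall C, P C -> (C <= D)%VS) -> (U <= D)%VS).

Lemma is_vsum_exists (P : {vspace V} -> Prop) : exists U, is_vsum P U.
Proof.
pose Q n := `[< exists2 s : seq {vspace V}, (forall C, C \in s -> P C)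
                & \dim (\sum_(C <- s) C)%VS = n >].
have exQ : exists n, Q n.
  by exists (\dim (0%VS : {vspace V})); apply/asboolP; exists [::]; rewrite ?big_nil.
have ubQ n : Q n -> (n <= \dim {:V})%N.
  by move/asboolP=> [s _ <-]; rewrite dimvS ?subvf.
case: (ex_maxnP exQ ubQ) => n /asboolP[s sP dims] maxn.
exists (\sum_(C <- s) C)%VS; split=> [C PC|D ubD]; last first.
  rewrite big_seq; elim/big_ind: _ => [|A B AD BD|C /sP/ubD //]; first exact: sub0v.
  by rewrite subv_add AD BD.
have Qs : Q (\dim (\sum_(A <- C :: s) A)%VS).
  apply/asboolP; exists (C :: s) => // A.
  by rewrite inE => /predU1P[-> //|/sP].
have /eqP-> : (\sum_(A <- s) A == \sum_(A <- C :: s) A)%VS.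
  by rewrite eqEdim dims maxn // andbT big_cons addvSr.
by rewrite big_cons addvSl.
Qed.

(* The sum of all simple subcoalgebras. *)
Definition coradical : {vspace V} := xget 0%VS (is_vsum simple_subcoalgebra).

Lemma coradicalP : is_vsum simple_subcoalgebra coradical.
Proof. exact: xgetPex (is_vsum_exists _). Qed.

Definition cosemisimple := coradical = fullv.

Definition grouplike g := (comul c g == g ⊗ g) && (counit c g == 1).

Lemma grouplike_free (s : seq V) : uniq s -> all grouplike s -> free s.
Proof.
elim: s => [|x s IHs] /=; first by rewrite nil_free.
case/andP=> xs us /andP[gx gs]; have fs := IHs us gs.
rewrite free_cons fs andbT; apply/negP=> xspan; case/negP: xs.
case/andP: gx => /eqP cx /eqP ex.
have x0 : x != 0.
  by apply: contra_eqN ex => /eqP->; rewrite linear0 eq_sym oner_eq0.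
pose a (i : 'I_(size s)) : k := coord (in_tuple s) i x.
have xE : x = \sum_i a i *: s`_i by rewrite {1}(coord_span (X := in_tuple s) xspan).
have sc i : (a i *: s`_i) = a i *: x.
  pose F := tlift (fun u v : V => coord (in_tuple s) i u *: v).
  have FE u v : F (u ⊗ v) = coord (in_tuple s) i u *: v.
    exact: tlift_scalel.
  have <- : F (comul c x) = a i *: x by rewrite cx FE.
  have Fs (j : 'I_(size s)) : F (comul c s`_j) = (j == i)%:R *: s`_j.
    have /allP/(_ s`_j)/(_ (mem_nth _ (ltn_ord j)))/andP[/eqP-> _] := gs.
    by rewrite FE (coord_free (X := in_tuple s)).
  rewrite {1}xE /F !linear_sum (bigD1 i) //= big1 => [|j /negPf ji].
    by rewrite addr0 !linearZ /= -/F Fs eqxx scale1r.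
  by rewrite !linearZ /= -/F Fs ji scale0r scaler0.
have [i ai|a0] := pickP (fun i => a i != 0).
  by rewrite -(scalerI ai (sc i)) mem_nth.
case/eqP: x0; rewrite xE big1 // => i _.
by move/negbFE/eqP: (a0 i) => ->; rewrite scale0r.
Qed.

Lemma grouplike_finite : finite_set [set g : V | grouplike g].
Proof.
apply: contrapT => /(infinite_set_fset (\dim {:V}).+1)[B BG].
apply/negP; rewrite -ltnNge ltnS.
have : free (B : seq V).
  by apply: grouplike_free; [exact: fset_uniq | apply/allP=> x xB; exact: BG].
by move/eqnP <-; rewrite dimvS ?subvf.
Qed.

(* The set G of grouplike elements; it is finite by [grouplike_finite]. *)
Definition grouplikes : {fset V} := fset_set [set g : V | grouplike g].

Lemma in_grouplikes g : (g \in grouplikes) = grouplike g.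
Proof. by rewrite in_fset_set ?inE; [apply/asboolP/idP | exact: grouplike_finite]. Qed.

Definition skew_primitive x : Prop :=
  exists g h, [/\ grouplike g, grouplike h & comul c x = g ⊗ x + x ⊗ h].

Definition nontrivial_skew_primitive x : Prop :=
  skew_primitive x /\ x \notin <<grouplikes>>%VS.

Definition coalg_projection U (p : 'End(V)) : Prop :=
  [/\ coalg_morph c c p, (limg p <= U)%VS & {in U, p =1 id}].

(* The subspace P_1 of the x such that Δ(x) = ρ_L(x) + ρ_R(x), where
   ρ_L = (p ⊗ id)Δ and ρ_R = (id ⊗ p)Δ. *)
Definition P1 (p : 'End(V)) : {vspace V} :=
  lker (comul c - ((tmap p \1 \o comul c) + (tmap \1 p \o comul c)))%VF.

Lemma mem_P1 (p : 'End(V)) x :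
  (x \in P1 p)
  = (comul c x == tmap p \1%VF (comul c x) + tmap \1%VF p (comul c x)).
Proof.
by rewrite memv_ker add_lfunE opp_lfunE add_lfunE !comp_lfunE subr_eq0.
Qed.

End CoalgebraTheory.

(* The subcoalgebra [U] of [W] is isomorphic to [V] as a coalgebra: the
   inverse of the isomorphism, followed by the inclusion of [U], is an
   injective coalgebra morphism with image [U]. *)
Definition subcoalg_iso (k : fieldType) (V W : vectType k)
    (d : coalgebra W) (U : {vspace W}) (c : coalgebra V) : Prop :=
  exists f : 'Hom(V, W), [/\ coalg_morph c d f, lker f = 0%VS & limg f = U].

(* Main.v *)
(* Fix the grouplike group G, the projection p with kernel I, and let q = 1 - p.
   Everything is computed in the convolution algebra H^* acting on H from both
   sides; P_1 is the set of x in I killed by J * J, where J is the ideal of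
   functionals vanishing on H_0, and it is a bimodule over the image of
   (H_0)^* = k^G x prod M_(n_i)(k), embedded in H^* by p.

   Divisibility.  G acts on P_1 by x |-> q(g x), compatibly with the right
   coaction (id ⊗ p) Δ.  The Hopf-module trace identity
   tr_(P_1)(g) (dim H - tr_H(g)) = 0 and the fact that an operator of finite
   order with trace dim H is the identity in characteristic 0 give
   tr_(P_1)(g) = 0 for g <> 1, so the rank of the averaging idempotent is
   dim P_1 / |G|.

   Lower bound.  P_1 is nonzero because H is not cosemisimple.  If some
   nonzero x in P_1 has a grouplike g as its right or left type (Δ x is
   ρ_L x + x ⊗ g or g ⊗ x + ρ_R x), translation by G and the injective antipode
   produce such elements of every type on both sides.  The 2|G| corresponding
   subspaces are independent, since there are no nontrivial skew primitives,
   and each carries an action of some M_(n_i)(k), hence has dimension at least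
   n_1.  Otherwise P_1 contains a nonzero bimodule over some M_(n_i)(k) and
   M_(n_j)(k), of dimension at least n_i n_j >= n_1^2. *)
From HB Require Import structures.
Require Import Defs.
From mathcomp Require Import all_boot all_order all_algebra all_solvable.
From mathcomp Require Import all_field finmap boolp ring.

Set Implicit Arguments.
Unset Strict Implicit.
Unset Printing Implicit Defensive.

Import Order.TTheory GRing.Theory Num.Theory.
Local Open Scope ring_scope.

(** * Functionals and the convolution algebra *)

Section Functionals.
Variables (k : fieldType).
Implicit Types (U V W : vectType k).

(** Coordinates are functionals. Identities between vectors are from here on checked after pairing,
    which replaces Sweedler notation by computations with [conv]. *)
Lemma functional_ext V (x y : V) :
  (forall a : 'Hom(V, k^o), a x = a y) -> x = y.
Proof.
move=> xy; rewrite (coord_vbasis (memvf x)) (coord_vbasis (memvf y)).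
apply: eq_bigr => i _; have := xy (linfun (coord (vbasis {:V}) i : V -> k^o)).
by rewrite !lfunE /= => ->.
Qed.

Definition tpair V W (a : 'Hom(V, k^o)) (b : 'Hom(W, k^o)) :
    'Hom(tensor V W, k^o) :=
  linfun (tlift (fun u v => (a u * b v : k^o))).

Lemma tpairE V W (a : 'Hom(V, k^o)) (b : 'Hom(W, k^o)) u v :
  tpair a b (u ⊗ v) = a u * b v.
Proof.
rewrite lfunE /= tliftE // => [y|x] r z z'; rewrite linearP.
  by rewrite mulrDl -scalerAl.
by rewrite mulrDr -scalerAr.
Qed.

Lemma tpair_ext V W (s t : tensor V W) :
  (forall a b, tpair a b s = tpair a b t) -> s = t.
Proof.
have E (r : tensor V W) i j : r i j =
    tpair (linfun (coord (vbasis {:V}) i : V -> k^o))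
      (linfun (coord (vbasis {:W}) j : W -> k^o)) r.
  rewrite [in RHS](tensor_sum r) [in LHS](tensor_sum r) !linear_sum summxE.
  apply: eq_bigr => i' _; rewrite linear_sum summxE; apply: eq_bigr => j' _.
  by rewrite linearZ /= tpairE !lfunE /= !mxE.
by move=> st; apply/matrixP=> i j; rewrite !E st.
Qed.

Lemma tpair_tmap V V' W W' (f : 'Hom(V, V')) (g : 'Hom(W, W'))
    (a : 'Hom(V', k^o)) (b : 'Hom(W', k^o)) t :
  tpair a b (tmap f g t) = tpair (a \o f)%VF (b \o g)%VF t.
Proof.
rewrite -comp_lfunE; apply: tensor_ext => v w /=.
by rewrite comp_lfunE tmapE !tpairE !comp_lfunE.
Qed.

Lemma tpair_assoc U V W (a : 'Hom(U, k^o)) (b : 'Hom(V, k^o))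
    (e : 'Hom(W, k^o)) t :
  tpair a (tpair b e) (tassoc U V W t) = tpair (tpair a b) e t.
Proof.
rewrite -comp_lfunE; apply: tensor_ext => s w /=; rewrite comp_lfunE.
rewrite [s]tensor_sum pure_suml !linear_sum; apply: eq_bigr => i _.
rewrite pure_suml !linear_sum; apply: eq_bigr => j _.
by rewrite pureZl !linearZ /= tassocE !tpairE mulrA.
Qed.

Lemma tlift_funl V W (a : 'Hom(V, k^o)) v (w : W) :
  tlift (fun x y => a x *: y) (v ⊗ w) = a v *: w.
Proof.
rewrite tliftE // => [y|x] r u u'; first by rewrite linearP scalerDl scalerA.
by rewrite scalerDr !scalerA mulrC.
Qed.

Lemma tlift_funr V W (a : 'Hom(W, k^o)) (v : V) w :
  tlift (fun x y => a y *: x) (v ⊗ w) = a w *: v.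
Proof.
rewrite tliftE // => [y|x] r u u'; last by rewrite linearP scalerDl scalerA.
by rewrite scalerDr !scalerA mulrC.
Qed.

Lemma tpair_lift V W (a : 'Hom(V, k^o)) (b : 'Hom(W, k^o)) (t : tensor V W) :
  tpair a b t = b (tlift (fun u v => a u *: v) t).
Proof.
rewrite -[RHS]/((b \o tlift _) t); apply: tensor_ext => v w /=.
by rewrite tpairE tlift_funl linearZ.
Qed.

Lemma tpair_liftr V W (a : 'Hom(V, k^o)) (b : 'Hom(W, k^o)) (t : tensor V W) :
  tpair a b t = a (tlift (fun u v => b v *: u) t).
Proof.
rewrite -[RHS]/((a \o tlift _) t); apply: tensor_ext => v w /=.
by rewrite tpairE tlift_funr linearZ /= mulrC.
Qed.

Lemma tpairDl V W (a a' : 'Hom(V, k^o)) (b : 'Hom(W, k^o)) r t :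
  tpair (r *: a + a') b t = r * tpair a b t + tpair a' b t.
Proof. by rewrite !tpair_liftr add_lfunE scale_lfunE. Qed.

Lemma tpairDr V W (a : 'Hom(V, k^o)) (b b' : 'Hom(W, k^o)) r t :
  tpair a (r *: b + b') t = r * tpair a b t + tpair a b' t.
Proof. by rewrite !tpair_lift add_lfunE scale_lfunE. Qed.

End Functionals.

(** * The dual algebra and its two actions *)

Section Convolution.
Variables (k : fieldType) (V : vectType k) (c : coalgebra V).
Implicit Types (a b e : 'Hom(V, k^o)) (x y : V) (U W C D : {vspace V}).

Definition eps : 'Hom(V, k^o) := linfun (counit c : V -> k^o).

Definition conv a b : 'Hom(V, k^o) := (tpair a b \o comul c)%VF.

(** In Sweedler notation [ract a x] is x_1 a(x_2) and [lact a x] is a(x_1) x_2. They make V a left,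
    respectively right, module over the dual algebra; the submodules are the right, respectively
    left, subcomodules. *)
Definition ract a : 'End(V) :=
  (linfun (tlift (fun u v => a v *: u)) \o comul c)%VF.

Definition lact a : 'End(V) :=
  (linfun (tlift (fun u v => a u *: v)) \o comul c)%VF.

Lemma epsE x : eps x = counit c x. Proof. by rewrite lfunE. Qed.

Lemma convE a b x : conv a b x = tpair a b (comul c x).
Proof. by rewrite comp_lfunE. Qed.

Lemma conv_ract a b x : conv a b x = a (ract b x).
Proof. by rewrite convE tpair_liftr comp_lfunE [in RHS]lfunE. Qed.

Lemma conv_lact a b x : conv a b x = b (lact a x).
Proof. by rewrite convE tpair_lift comp_lfunE [in RHS]lfunE. Qed.

Lemma convA a b e : conv a (conv b e) = conv (conv a b) e.
Proof.
apply/lfunP=> x; rewrite !convE.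
have -> : tpair a (conv b e) (comul c x) =
    tpair a (tpair b e) (tmap \1%VF (comul c) (comul c x)).
  by rewrite tpair_tmap comp_lfun1r.
have -> : tpair (conv a b) e (comul c x) =
    tpair (tpair a b) e (tmap (comul c) \1%VF (comul c x)).
  by rewrite tpair_tmap comp_lfun1r.
by rewrite -comulA tpair_assoc.
Qed.

Lemma ract_eps x : ract eps x = x.
Proof.
rewrite /ract comp_lfunE lfunE /= -[RHS](counitr c).
by apply: eq_bigr => i _; apply: eq_bigr => j _; rewrite epsE.
Qed.

Lemma lact_eps x : lact eps x = x.
Proof.
rewrite /lact comp_lfunE lfunE /= -[RHS](counitl c).
by apply: eq_bigr => i _; apply: eq_bigr => j _; rewrite epsE.
Qed.

Lemma conv_epsl a : conv eps a = a.
Proof. by apply/lfunP=> x; rewrite conv_lact lact_eps. Qed.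

Lemma conv_epsr a : conv a eps = a.
Proof. by apply/lfunP=> x; rewrite conv_ract ract_eps. Qed.

Lemma convDl r a a' b : conv (r *: a + a') b = r *: conv a b + conv a' b.
Proof.
by apply/lfunP=> x; rewrite add_lfunE scale_lfunE !convE tpairDl.
Qed.

Lemma convDr r a b b' : conv a (r *: b + b') = r *: conv a b + conv a b'.
Proof.
by apply/lfunP=> x; rewrite add_lfunE scale_lfunE !convE tpairDr.
Qed.

HB.instance Definition _ a :=
  GRing.isLinear.Build k 'Hom(V, k^o) 'Hom(V, k^o) _ (conv a)
    (fun r b b' => convDr r a b b').

Lemma lact_is_linear : linear lact.
Proof.
move=> r a a'; apply/lfunP=> x; apply: functional_ext => b.
by rewrite add_lfunE scale_lfunE linearP /= -!conv_lact convDl add_lfunE scale_lfunE.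
Qed.

HB.instance Definition _ :=
  GRing.isLinear.Build k 'Hom(V, k^o) 'End(V) _ lact lact_is_linear.

Lemma ract_is_linear : linear ract.
Proof.
move=> r a a'; apply/lfunP=> x; apply: functional_ext => b.
by rewrite add_lfunE scale_lfunE linearP /= -!conv_ract convDr add_lfunE scale_lfunE.
Qed.

HB.instance Definition _ :=
  GRing.isLinear.Build k 'Hom(V, k^o) 'End(V) _ ract ract_is_linear.

Lemma eps_ract a x : eps (ract a x) = a x.
Proof. by rewrite -conv_ract conv_epsl. Qed.

Lemma lact_ract a b x : lact a (ract b x) = ract b (lact a x).
Proof.
by apply: functional_ext => e; rewrite -conv_lact -!conv_ract -conv_lact convA.
Qed.

Lemma lact_lact a b x : lact a (lact b x) = lact (conv b a) x.
Proof. by apply: functional_ext => e; rewrite -!conv_lact convA. Qed.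

Lemma ract_ract a b x : ract a (ract b x) = ract (conv a b) x.
Proof. by apply: functional_ext => e; rewrite -!conv_ract convA. Qed.

Definition rstable U := forall a x, x \in U -> ract a x \in U.
Definition lstable U := forall a x, x \in U -> lact a x \in U.

(** If Δ(x) lies in C ⊗ C, contracting either factor stays in C. Conversely, when both contractions
    stay in C, Δ(x) is fixed by the tensor square of a projection onto C. *)
Lemma subcoalgebraP C : subcoalgebra c C <-> rstable C /\ lstable C.
Proof.
split=> [sC|[rC lC]].
  have Cx x : x \in C -> comul c x \in tensorv C C.
    by move=> xC; apply: (subvP sC); apply: memv_img.
  have gen (f : {linear tensor V V -> V}) x :
      (forall u w, u \in C -> w \in C -> f (u ⊗ w) \in C) -> x \in C ->
      f (comul c x) \in C.
    move=> fC /Cx; set L := [seq u ⊗ w | u <- vbasis C, w <- vbasis C].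
    move/(@coord_span _ _ _ (in_tuple L)) => ->; rewrite linear_sum.
    apply: memv_suml => i _; rewrite linearZ memvZ //.
    have /allpairsP[[u w] /= [uC wC ->]] : (in_tuple L)`_i \in L.
      by rewrite mem_nth.
    by apply: fC; apply: vbasis_mem.
  split=> a x xC; rewrite comp_lfunE lfunE; apply: gen => // u w uC wC.
    by rewrite /= tlift_funr memvZ.
  by rewrite /= tlift_funl memvZ.
apply/subvP=> _ /memv_imgP[x xC ->].
have pC y : y \in C -> projv C y = y by apply: projv_id.
have -> : comul c x = tmap (projv C) (projv C) (comul c x).
  apply: tpair_ext => a b; rewrite tpair_tmap -!convE.
  rewrite [RHS]conv_lact comp_lfunE pC ?lC // -conv_lact conv_ract.
  by rewrite [RHS]conv_ract comp_lfunE pC ?rC.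
rewrite [comul c x]tensor_sum linear_sum; apply: memv_suml => i _.
rewrite linear_sum; apply: memv_suml => j _; rewrite linearZ memvZ //= tmapE.
by apply: mem_tensorv; apply: memv_proj.
Qed.

Lemma rstableI U W : rstable U -> rstable W -> rstable (U :&: W).
Proof.
by move=> rU rW a x; rewrite !memv_cap => /andP[xU xW]; rewrite rU ?rW.
Qed.

End Convolution.

(** * The coradical and P_1 *)

Lemma minimal_subspace (k : fieldType) (V : vectType k)
    (P : {vspace V} -> Prop) (U : {vspace V}) : P U ->
  exists W, [/\ P W, (W <= U)%VS & forall X, P X -> (X <= W)%VS -> X = W].
Proof.
move=> PU; pose Q n := `[< exists2 W, P W /\ (W <= U)%VS & \dim W = n >].
have exQ : exists n, Q n by exists (\dim U); apply/asboolP; exists U.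
case: (ex_minnP exQ) => _ /asboolP[W [PW WU] <-] minW.
exists W; split=> // X PX XW; apply/eqP; rewrite eqEdim XW.
by apply: minW; apply/asboolP; exists X => //; split=> //; apply: subv_trans XW WU.
Qed.

Section Coradical.
Variables (k : fieldType) (V : vectType k) (c : coalgebra V).
Implicit Types (a b e : 'Hom(V, k^o)) (x y : V) (U W C D : {vspace V}).

Local Notation conv := (conv c).
Local Notation lact := (lact c).
Local Notation ract := (ract c).
Local Notation eps := (eps c).
Local Notation H0 := (coradical c).
Local Notation rstable := (rstable c).
Local Notation lstable := (lstable c).

Lemma simple_sub_coradical C : simple_subcoalgebra c C -> (C <= H0)%VS.
Proof. by case: (coradicalP c) => + _; apply. Qed.

Lemma coradical_min D :
  (forall C, simple_subcoalgebra c C -> (C <= D)%VS) -> (H0 <= D)%VS.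
Proof. by case: (coradicalP c) => _; apply. Qed.

(** The x with [ract a x] in H_0 form a subspace that contains each simple subcoalgebra, hence their
    sum. *)
Lemma coradical_rstable : rstable H0.
Proof.
move=> a x xH; rewrite memv_preim; move: x xH; apply/subvP.
apply: coradical_min => C sC; apply/subvP=> x xC; rewrite -memv_preim.
apply: (subvP (simple_sub_coradical sC)).
by case: sC => /subcoalgebraP[rC _] _ _; apply: rC.
Qed.

Lemma coradical_lstable : lstable H0.
Proof.
move=> a x xH; rewrite memv_preim; move: x xH; apply/subvP.
apply: coradical_min => C sC; apply/subvP=> x xC; rewrite -memv_preim.
apply: (subvP (simple_sub_coradical sC)).
by case: sC => /subcoalgebraP[_ lC] _ _; apply: lC.
Qed.

(** A minimal nonzero subcoalgebra of C is simple, so it lies in H_0. *)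
Lemma subcoalgebra_meets_coradical C :
  subcoalgebra c C -> C <> 0%VS -> (C :&: H0 != 0)%VS.
Proof.
move=> sC C0.
have [|W [[sW W0] WC Wmin]] :=
  @minimal_subspace _ _ (fun D => subcoalgebra c D /\ D <> 0%VS) C; first by [].
have WH : (W <= H0)%VS.
  apply: simple_sub_coradical; split=> // D sD DW.
  by case: (pselect (D = 0%VS)) => [|D0]; [left | right; apply: Wmin].
apply/eqP=> CH0; apply: W0; apply/eqP; rewrite -subv0 -CH0 subv_cap WC.
exact: WH.
Qed.

Definition vanish a U := forall x, x \in U -> a x = 0.

(** Double annihilator: the functionals a ∘ (1 - [projv U]) vanish on U and together detect the
    component of x outside U. *)
Lemma vanishP x U : (forall a, vanish a U -> a x = 0) -> x \in U.
Proof.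
move=> xv; have: x - projv U x = 0.
  apply: functional_ext => a; rewrite linear0.
  have := xv (a \o (\1 - projv U))%VF; rewrite comp_lfunE !lfun_simp; apply.
  by move=> y yU; rewrite comp_lfunE !lfun_simp projv_id // subrr linear0.
by move/eqP; rewrite subr_eq0 => /eqP->; apply: memv_proj.
Qed.

Lemma lact_vanish a U x : rstable U -> vanish a U -> x \in U -> lact a x = 0.
Proof.
move=> rU aU xU; apply: functional_ext => b.
by rewrite linear0 -conv_lact conv_ract aU // rU.
Qed.

Lemma ract_vanish a U x : lstable U -> vanish a U -> x \in U -> ract a x = 0.
Proof.
move=> lU aU xU; apply: functional_ext => b.
by rewrite linear0 -conv_ract conv_lact aU // lU.
Qed.

(** The simple right subcomodules of V. *)
Definition rsimple W :=
  [/\ rstable W, W <> 0%VS &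
    forall X, rstable X -> (X <= W)%VS -> X = 0%VS \/ X = W].

Lemma rstable_preim_lact a U W :
  rstable U -> rstable W -> rstable (U :&: (lact a @^-1: W)).
Proof.
move=> rU rW b x; rewrite !memv_cap -!memv_preim => /andP[xU xW].
by rewrite rU //= lact_ract rW.
Qed.

Lemma rstable_img_lact a W : rstable W -> rstable (lact a @: W).
Proof.
by move=> rW b _ /memv_imgP[x xW ->]; rewrite -lact_ract memv_img // rW.
Qed.

(** As in Schur's lemma: [lact a] commutes with [ract], so the part of W that it sends into X is a
    submodule of W, hence 0 or W. *)
Lemma rsimple_lact a W X : rsimple W -> rstable X ->
  (lact a @: W :&: X = 0)%VS \/ (lact a @: W <= X)%VS.
Proof.
case=> rW W0 minW rX.
case: (minW _ (@rstable_preim_lact a _ _ rW rX) (capvSl _ _)) => WX.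
  left; apply/eqP; rewrite -subv0; apply/subvP=> y; rewrite memv_cap.
  case/andP=> /memv_imgP[w wW ->] wX.
  have: w \in (0%VS : {vspace V}) by rewrite -WX memv_cap wW -memv_preim.
  by rewrite memv0 => /eqP->; rewrite linear0 mem0v.
right; apply/subvP=> _ /memv_imgP[w + ->].
by rewrite -{1}WX memv_cap -memv_preim => /andP[].
Qed.

(** When s spans the dual space and W is [rstable], this is the subcoalgebra generated by W. *)
Definition lspan (s : seq 'Hom(V, k^o)) W := (\sum_(a <- s) lact a @: W)%VS.

Lemma rstable_lspan s W : rstable W -> rstable (lspan s W).
Proof.
move=> rW; rewrite /lspan; elim: s => [|a s IHs] b x.
  by rewrite big_nil !memv0 => /eqP->; rewrite linear0.
rewrite big_cons => /memv_addP[y yW [z zs ->]]; rewrite linearD memv_add ?IHs //.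
exact: rstable_img_lact.
Qed.

(* If J is the ideal of functionals vanishing on H0 and JW = W, then also
   J(lact a W) = lact a W, hence J cannot kill a nonzero element of the
   semisimple module [lspan s W]. *)
Lemma lspan_coradical s W :
  rsimple W -> (W :&: H0 = 0)%VS -> (lspan s W :&: H0 = 0)%VS.
Proof.
move=> sW WH; have [rW W0 minW] := sW.
have JH a x : vanish a H0 -> x \in H0 -> ract a x = 0.
  by move=> aH; apply: ract_vanish aH; apply: coradical_lstable.
have one a : (lact a @: W :&: H0 = 0)%VS.
  case: (@rsimple_lact a _ _ sW coradical_rstable) => [//|aWH].
  suff aW w : w \in W -> lact a w = 0.
    apply/eqP; rewrite -subv0; apply/subvP=> y; rewrite memv_cap.
    by case/andP=> /memv_imgP[w wW ->] _; rewrite aW // mem0v.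
  pose K := (W :&: (lact a @^-1: 0))%VS.
  have r0 : rstable 0%VS.
    by move=> b x; rewrite !memv0 => /eqP->; rewrite linear0.
  move=> wW; case: (minW _ (@rstable_preim_lact a _ _ rW r0) (capvSl _ _)) => K0.
    have: w \in (W :&: H0)%VS.
      rewrite memv_cap wW; apply: vanishP => b bH.
      rewrite -(eps_ract c b w); have ->: ract b w = 0; last by rewrite linear0.
      apply/eqP; rewrite -memv0 -K0 memv_cap rW //= -memv_preim memv0.
      by rewrite lact_ract JH // (subvP aWH) ?memv_img.
    by rewrite WH memv0 => /eqP->; rewrite linear0.
  by move: wW; rewrite -{1}K0 memv_cap -memv_preim memv0 => /andP[_ /eqP].
rewrite /lspan; elim: s => [|a s IHs]; first by rewrite big_nil cap0v.
rewrite big_cons; have rs : rstable (\sum_(b <- s) lact b @: W).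
  exact: rstable_lspan.
case: (@rsimple_lact a _ _ sW rs) => [as0|/addv_idPr->//].
apply/eqP; rewrite -subv0; apply/subvP=> z; rewrite memv_cap.
case/andP=> /memv_addP[y yW [u us ->]] yuH.
have J0 b : vanish b H0 -> ract b y = 0 /\ ract b u = 0.
  move=> bH; have yu : ract b y = - ract b u.
    by apply/eqP; rewrite -addr_eq0; move: (JH b _ bH yuH) => /eqP; rewrite linearD.
  have y0 : ract b y = 0.
    apply/eqP; rewrite -memv0 -as0 memv_cap; apply/andP; split.
      by apply: rstable_img_lact.
    by rewrite yu rpredN; apply: rs.
  by split=> //; move: yu => /eqP; rewrite y0 eq_sym oppr_eq0 => /eqP.
have yH : y \in H0.
  by apply: vanishP => b /J0[]; rewrite -(eps_ract c b y) => -> _; rewrite linear0.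
have uH : u \in H0.
  by apply: vanishP => b /J0[_]; rewrite -(eps_ract c b u) => ->; rewrite linear0.
have /eqP-> : y == 0 by rewrite -memv0 -(one a) memv_cap yW.
have /eqP-> : u == 0 by rewrite -memv0 -IHs memv_cap us.
by rewrite addr0 mem0v.
Qed.

(** Otherwise W meets H_0 trivially, and by [lspan_coradical] so does the subcoalgebra generated by
    W; but every nonzero subcoalgebra meets H_0. *)
Lemma rsimple_sub_coradical W : rsimple W -> (W <= H0)%VS.
Proof.
move=> sW; have [rW W0 minW] := sW.
have rWH : rstable (W :&: H0) by apply: rstableI => //; apply: coradical_rstable.
case: (minW _ rWH (capvSl _ _)) => [WH|<-]; last exact: capvSr.
pose s : seq 'Hom(V, k^o) := vbasis {:'Hom(V, k^o)}.
have sE a w : w \in W -> lact a w \in lspan s W.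
  move=> wW; rewrite (coord_vbasis (memvf a)) linear_sum sum_lfunE.
  apply: memv_suml => i _; rewrite linearZ scale_lfunE memvZ //.
  apply: (subvP _ _ (memv_img _ wW)).
  rewrite /lspan (big_nth 0) big_mkord.
  have ltn : (i < size s)%N by rewrite size_tuple.
  exact: (sumv_sup (Ordinal ltn)).
have: (lspan s W :&: H0 != 0)%VS.
  apply: subcoalgebra_meets_coradical; last first.
    move=> C0; apply: W0; apply/eqP; rewrite -subv0 -C0; apply/subvP=> w wW.
    by rewrite -[w](lact_eps c) sE.
  apply/subcoalgebraP; split; first exact: rstable_lspan.
  (* The induction runs over a sublist r while the target keeps the whole basis s, because
     [conv b a] need not lie in the span of r. *)
  move=> a; suff: forall r, all (mem s) r ->
      forall x, x \in lspan r W -> lact a x \in lspan s W.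
    by move/(_ s); apply; apply/allP.
  elim=> [|b r IHr] /= => [_ x|/andP[bs rs] x].
    by rewrite /lspan big_nil memv0 => /eqP->; rewrite linear0 mem0v.
  rewrite {1}/lspan big_cons => /memv_addP[_ /memv_imgP[w wW ->] [z zr ->]].
  rewrite linearD; apply: memvD; last exact: IHr.
  by rewrite /= lact_lact; apply: sE.
by rewrite lspan_coradical ?eqxx.
Qed.

(** V1 is minimal among the right subcomodules outside H_0. If a vanishes on H_0, then [lact a]
    kills H_0 and thus all proper subcomodules of V1, so its image on V1 is zero or simple, hence
    inside H_0, where b vanishes. *)
Lemma noncosemisimple_minimal : ~ cosemisimple c ->
  exists V1, [/\ rstable V1, ~~ (V1 <= H0)%VS &
    forall a b x, vanish a H0 -> vanish b H0 -> x \in V1 -> conv a b x = 0].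
Proof.
move=> ncs.
have [|V1 [[rV nV] _ minV]] :=
  @minimal_subspace _ _ (fun U => rstable U /\ ~~ (U <= H0)%VS) fullv.
  split; first by move=> *; apply: memvf.
  by apply/negP=> fH; apply: ncs; apply/eqP; rewrite eqEsubv subvf.
exists V1; split=> // a b x aH bH xV; rewrite conv_lact; apply: bH.
case: (pselect ((lact a @: V1)%VS = 0%VS)) => [aV0|aV0].
  have: lact a x \in (lact a @: V1)%VS by rewrite memv_img.
  by rewrite aV0 memv0 => /eqP->; apply: mem0v.
apply: (subvP (@rsimple_sub_coradical (lact a @: V1)%VS _)); last first.
  by rewrite memv_img.
split=> // [|X rX XV]; first exact: rstable_img_lact.
pose K := (V1 :&: (lact a @^-1: X))%VS.
have rK : rstable K by apply: rstable_preim_lact.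
have [KH|nKH] := boolP (K <= H0)%VS; [left|right].
  apply/eqP; rewrite -subv0; apply/subvP=> y yX.
  have /memv_imgP[v vV yE] := subvP XV _ yX.
  rewrite yE (lact_vanish coradical_rstable aH) ?mem0v //.
  by apply: (subvP KH); rewrite memv_cap vV -memv_preim -yE.
apply/eqP; rewrite eqEsubv XV; apply/subvP=> _ /memv_imgP[v vV ->].
by move: vV; rewrite -(minV K) ?capvSl // memv_cap -memv_preim => /andP[].
Qed.

End Coradical.

(** * Dual description of P_1 *)

Section Projection.
Variables (k : fieldType) (V : vectType k) (c : coalgebra V) (p : 'End(V)).
Hypothesis p_proj : coalg_projection c (coradical c) p.
Implicit Types (a b e : 'Hom(V, k^o)) (x y : V).

Local Notation conv := (conv c).
Local Notation lact := (lact c).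
Local Notation ract := (ract c).
Local Notation eps := (eps c).
Local Notation H0 := (coradical c).
Local Notation q := (\1 - p)%VF.

Lemma proj_in x : p x \in H0.
Proof. by case: p_proj => _ pH _; apply: (subvP pH); apply: memv_img; apply: memvf. Qed.

Lemma proj_id x : x \in H0 -> p x = x.
Proof. by case: p_proj => _ _; apply. Qed.

Lemma projK x : p (p x) = p x. Proof. exact: proj_id (proj_in x). Qed.

Lemma proj_conv a b : conv (a \o p)%VF (b \o p)%VF = (conv a b \o p)%VF.
Proof.
apply/lfunP=> x; rewrite comp_lfunE !convE -tpair_tmap.
by case: p_proj => -[-> _].
Qed.

Lemma proj_eps : (eps \o p)%VF = eps.
Proof.
by apply/lfunP=> x; rewrite comp_lfunE !epsE; case: p_proj => -[_ ->].
Qed.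

Lemma qE x : q x = x - p x.
Proof. by rewrite add_lfunE opp_lfunE id_lfunE. Qed.

Lemma vanishq a : vanish (a \o q)%VF H0.
Proof. by move=> x xH; rewrite comp_lfunE qE proj_id // subrr linear0. Qed.

Lemma vanish_q a : vanish a H0 -> (a \o q)%VF = a.
Proof.
move=> aH; apply/lfunP=> x.
rewrite comp_lfunE qE linearB /= (aH (p x)) ?subr0 //.
exact: proj_in.
Qed.

Lemma comp_split a : a = (a \o p)%VF + (a \o q)%VF.
Proof. by apply/lfunP=> x; rewrite add_lfunE !comp_lfunE qE linearB /= addrCA subrr addr0. Qed.

(** This is P_1 = I ∩ H_1 in dual form: H_1 is the annihilator of the square of the ideal of
    functionals vanishing on H_0. *)
Lemma P1P x : x \in P1 c p <->
  p x = 0 /\ forall a b, vanish a H0 -> vanish b H0 -> conv a b x = 0.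
Proof.
(* Expansion of (q ⊗ q)Δ; its p ⊗ p term is Δp, since p is a coalgebra morphism. The equation of P_1
   thus says that [conv (a \o q) (b \o q) x] equals [conv a b (p x)] for all a and b. *)
rewrite mem_P1; have E a b : conv (a \o q)%VF (b \o q)%VF x =
    conv a b x - (conv (a \o p)%VF b x + conv a (b \o p)%VF x)
      + conv a b (p x).
  rewrite -[conv a b (p x)]comp_lfunE -proj_conv !convE.
  have eqE e : (e \o q)%VF = ((-1) *: (e \o p) + e)%VF.
    apply/lfunP=> y; rewrite add_lfunE scale_lfunE.
    by rewrite !comp_lfunE qE linearB /= scaleN1r addrC.
  rewrite !eqE !tpairDl !tpairDr !mulN1r.
  by move: (tpair a b _) (tpair _ b _) (tpair a _ _) (tpair _ _ _) => r s t u; ring.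
split=> [/eqP Dx|[px0 JJ]].
  have DxE a b : conv (a \o q)%VF (b \o q)%VF x = conv a b (p x).
    rewrite E; apply/eqP; rewrite -subr_eq0 addrK subr_eq0.
    rewrite !convE {1}Dx linearD /= !tpair_tmap.
    by rewrite !comp_lfun1r.
  (* With a ∘ p and the counit as the two functionals, the left side of [DxE] vanishes and the right
     side is a(p x). *)
  have px0 : p x = 0.
    apply: functional_ext => a; rewrite linear0.
    rewrite -[in LHS](conv_epsr c a) -projK.
    rewrite -[conv _ _ (p _)]comp_lfunE -proj_conv proj_eps -DxE.
    have ->: ((a \o p) \o q)%VF = 0.
      apply/lfunP=> y; rewrite !comp_lfunE qE linearB /= projK subrr.
      by rewrite linear0 zero_lfunE.
    by rewrite convE tpair_liftr zero_lfunE.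
  split=> // a b aH bH; rewrite -(vanish_q aH) -(vanish_q bH) DxE px0.
  by rewrite linear0.
apply/eqP/tpair_ext => a b; rewrite linearD /= !tpair_tmap !comp_lfun1r.
rewrite -!convE; apply/eqP; rewrite -subr_eq0.
have /eqP := E a b; rewrite JJ; try exact: vanishq.
by rewrite px0 [conv a b 0]linear0 addr0 eq_sym.
Qed.

(** For v in the minimal subcomodule but outside H_0, the element v - p v is nonzero; p kills it,
    and products of functionals vanishing on H_0 kill both v and p v. *)
Lemma P1_nonzero : ~ cosemisimple c -> P1 c p != 0%VS.
Proof.
case/noncosemisimple_minimal=> U [_ /subvPn[v vU vH] JJ].
apply/negP=> /eqP P0; case/negP: vH; suff: v - p v \in P1 c p.
  by rewrite P0 memv0 subr_eq0 => /eqP->; apply: proj_in.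
apply/P1P; split=> [|a b aH bH]; first by rewrite linearB /= projK subrr.
rewrite linearB /= JJ // -[conv _ _ _]comp_lfunE -proj_conv convE.
have -> : (a \o p)%VF = 0.
  by apply/lfunP=> x; rewrite comp_lfunE zero_lfunE aH // proj_in.
by rewrite tpair_liftr zero_lfunE subrr.
Qed.

End Projection.

(** * Comatrices and the antipode *)

Section Comatrix.
Variables (k : fieldType) (V : vectType k) (c : coalgebra V).
Implicit Types (a b : 'Hom(V, k^o)) (x y : V) (I : finType).

(** These are the coefficient matrices of comodules; the entries need not be independent. Since such
    entries span V, they replace Sweedler notation in the antipode identities. *)
Definition comatrix I (m : I -> I -> V) : Prop :=
  (forall i j, comul c (m i j) = \sum_r m i r ⊗ m r j) /\
  (forall i j, counit c (m i j) = (i == j)%:R).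

Lemma comatrix_morph I (m : I -> I -> V) (f : 'End(V)) :
  coalg_morph c c f -> comatrix m -> comatrix (fun i j => f (m i j)).
Proof.
move=> [fD fe] [mD me]; split=> i j; last by rewrite fe.
by rewrite fD mD linear_sum; apply: eq_bigr => r _; rewrite /= tmapE.
Qed.

Lemma coalg_morph_id : coalg_morph c c \1%VF.
Proof.
split=> x; last by rewrite id_lfunE.
apply: tpair_ext => a b.
by rewrite tpair_tmap !comp_lfun1r id_lfunE.
Qed.

Lemma coalg_morph_conv (f : 'End(V)) a b x : coalg_morph c c f ->
  conv c a b (f x) = conv c (a \o f)%VF (b \o f)%VF x.
Proof. by case=> fD _; rewrite !convE fD tpair_tmap. Qed.

(* The matrix of the comodule M over the image of [f]. *)
Definition coef_mx (f : 'End(V)) (M : {vspace V}) (i j : 'I_(\dim M)) : V :=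
  f (lact c (linfun (coord (vbasis M) i : V -> k^o)) (vbasis M)`_j).

Lemma coef_mxP (f : 'End(V)) (M : {vspace V}) a (i j : 'I_(\dim M)) :
  a (coef_mx f i j) =
  coord (vbasis M) i (ract c (a \o f)%VF (vbasis M)`_j).
Proof. by rewrite /coef_mx -comp_lfunE -conv_lact conv_ract lfunE. Qed.

(** The maps [ract c (a \o f)] represent the dual algebra on M: multiplicativity of the
    representation is the rule for Δ, and the counit acts as the identity. *)
Lemma coef_comatrix (f : 'End(V)) (M : {vspace V}) : coalg_morph c c f ->
  (forall a x, x \in M -> ract c (a \o f)%VF x \in M) ->
  comatrix (@coef_mx f M).
Proof.
move=> fm fM; split=> i j.
  apply: tpair_ext => a b; rewrite -convE coalg_morph_conv // linear_sum.
  rewrite -conv_lact convA conv_ract.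
  have Mj : (vbasis M)`_j \in M by apply/vbasis_mem/mem_nth; rewrite size_tuple.
  rewrite (coord_vbasis (fM b _ Mj)) linear_sum; apply: eq_bigr => r _.
  by rewrite linearZ /= tpairE -coef_mxP conv_lact comp_lfunE [RHS]mulrC.
rewrite -epsE coef_mxP.
have -> : (eps c \o f)%VF = eps c.
  by apply/lfunP=> x; rewrite comp_lfunE !epsE; case: fm.
by rewrite ract_eps coord_free ?(basis_free (vbasisP M)) // eq_sym.
Qed.

Lemma comatrix_ext (U : lmodType k) (f g : {linear V -> U}) :
  (forall I (m : I -> I -> V), comatrix m ->
     forall i j, f (m i j) = g (m i j)) ->
  f =1 g.
Proof.
move=> fg x; rewrite (coord_vbasis (memvf x)) !linear_sum.
apply: eq_bigr => j _; rewrite !linearZ /=; congr (_ *: _).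
have cm := coef_comatrix coalg_morph_id (fun a x _ => memvf (ract c (a \o \1)%VF x)).
(* Applying the counit to the first factor of Δ(e_j), the sum of the e_i ⊗ c_ij, writes e_j through
   entries of a comatrix. *)
have -> : (vbasis {:V})`_j =
    \sum_(i < \dim {:V}) eps c (vbasis {:V})`_i *: coef_mx \1%VF i j.
  apply: functional_ext => a; rewrite -[a in LHS](conv_epsl c).
  rewrite conv_ract (coord_vbasis (memvf (ract c a _))) !linear_sum.
  apply: eq_bigr => i _.
  by rewrite !linearZ /= coef_mxP comp_lfun1r [LHS]mulrC.
rewrite !linear_sum; apply: eq_bigr => i _; rewrite !linearZ /=.
by rewrite (fg _ _ cm).
Qed.

End Comatrix.

(** Associativity evaluates f g h in two ways. The product [mu] is kept abstract so as to cover H,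
    its opposite algebra and H ⊗ H. *)
Lemma inverse_unique (k : fieldType) (U : lmodType k) (mu : U -> U -> U)
    (one : U) (I : finType) (f g h : I -> I -> U) :
    associative mu -> left_id one mu -> right_id one mu ->
    (forall y, linear (mu^~ y)) -> (forall x, linear (mu x)) ->
    (forall i j, \sum_r mu (f i r) (g r j) = (i == j)%:R *: one) ->
    (forall i j, \sum_r mu (g i r) (h r j) = (i == j)%:R *: one) ->
  forall i j, f i j = h i j.
Proof.
move=> mA m1 mr1 lin_l lin_r fg gh i j.
pose L y : {linear U -> U} :=
  HB.pack (mu^~ y) (GRing.isLinear.Build k U U _ (mu^~ y) (lin_l y)).
pose R x : {linear U -> U} :=
  HB.pack (mu x) (GRing.isLinear.Build k U U _ (mu x) (lin_r x)).
transitivity (\sum_r mu (f i r) (\sum_s mu (g r s) (h s j))).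
  rewrite (bigD1 j) //= gh eqxx scale1r mr1 big1 ?addr0 // => r /negPf rj.
  by rewrite gh rj scale0r -[LHS]/(R _ 0) linear0.
transitivity (\sum_s mu (\sum_r mu (f i r) (g r s)) (h s j)); last first.
  rewrite (bigD1 i) //= fg eqxx scale1r m1 big1 ?addr0 // => r /negPf ri.
  by rewrite fg eq_sym ri scale0r -[LHS]/(L _ 0) linear0.
rewrite (eq_bigr _ (fun r _ => linear_sum (R (f i r)) _ _ _)).
rewrite [RHS](eq_bigr _ (fun s _ => linear_sum (L (h s j)) _ _ _)).
by rewrite exchange_big; apply: eq_bigr => s _; apply: eq_bigr => r _ /=.
Qed.

(** * The algebra H ⊗ H *)

Section TensorAlgebra.
Variables (k : fieldType) (H : falgType k).
Implicit Types s t u : tensor H H.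

Lemma tmul_linearl t : linear (fun s => tmul s t).
Proof. by move=> r s s'; rewrite /tmul linearP. Qed.

Lemma tmul_linearr s : linear (fun t => tmul s t).
Proof.
have E t : tmul s t = \sum_i \sum_j (s : 'M_(_, _)) i j *:
    tlift (fun x y => ((vbasis {:H})`_i * x) ⊗ ((vbasis {:H})`_j * y)) t by [].
move=> r t t'; rewrite !E scaler_sumr -big_split; apply: eq_bigr => i _ /=.
rewrite scaler_sumr -big_split; apply: eq_bigr => j _ /=.
by rewrite linearP /= scalerDr !scalerA mulrC.
Qed.

HB.instance Definition _ s :=
  GRing.isLinear.Build k (tensor H H) (tensor H H) _ (@tmul k H s) (@tmul_linearr s).

Lemma tmul_suml I (r : seq I) P (F : I -> tensor H H) t :
  tmul (\sum_(i <- r | P i) F i) t = \sum_(i <- r | P i) tmul (F i) t.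
Proof. by rewrite /tmul linear_sum. Qed.

Lemma tmul0l t : tmul 0 t = 0.
Proof. by rewrite /tmul linear0. Qed.

Lemma tmul0r s : tmul s 0 = 0.
Proof. exact: (linear0 (@tmul k H s)). Qed.

Lemma tensor_pure_ind (P : tensor H H -> Prop) :
  (forall z s t, P s -> P t -> P (z *: s + t)) -> P 0 ->
  (forall x y, P (x ⊗ y)) -> forall t, P t.
Proof.
move=> Plin P0 Ppure t; rewrite [t]tensor_sum.
have PD s s' : P s -> P s' -> P (s + s').
  by move=> Ps Ps'; rewrite -[s]scale1r; apply: Plin.
elim/big_ind: _ => // i _; elim/big_ind: _ => // j _.
by rewrite -[_ *: _]addr0; apply: Plin.
Qed.

Lemma tmulA : associative (@tmul k H).
Proof.
move=> s t u; elim/tensor_pure_ind: s => [z s s' Hs Hs'||x y].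
- by rewrite !tmul_linearl Hs Hs'.
- by rewrite !tmul0l.
elim/tensor_pure_ind: t => [z t t' Ht Ht'||x' y'].
- by rewrite !(tmul_linearl, tmul_linearr) Ht Ht'.
- by rewrite !(tmul0l, tmul0r).
elim/tensor_pure_ind: u => [z u u' Hu Hu'||x'' y''].
- by rewrite !tmul_linearr Hu Hu'.
- by rewrite !tmul0r.
by rewrite !tmulE !mulrA.
Qed.

Lemma tmul1l : left_id (1 ⊗ 1) (@tmul k H).
Proof.
elim/tensor_pure_ind=> [z s s' Hs Hs'||x y]; last by rewrite tmulE !mul1r.
  by rewrite tmul_linearr Hs Hs'.
by rewrite linear0.
Qed.

Lemma tmul1r : right_id (1 ⊗ 1) (@tmul k H).
Proof.
elim/tensor_pure_ind=> [z s s' Hs Hs'||x y]; last by rewrite tmulE !mulr1.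
  by rewrite tmul_linearl Hs Hs'.
by rewrite tmul0l.
Qed.

End TensorAlgebra.

(** * The antipode reverses products and coproducts *)

Section Antipode.
Variables (k : fieldType) (H : falgType k) (A : hopf_algebra H).
Implicit Types (a b : 'Hom(H, k^o)) (x y : H) (I J : finType).
Local Notation S := (antipode A).
Local Notation comatrix := (comatrix A).

Lemma tlift_mulE (f g : 'End(H)) x y :
  tlift (fun u v => f u * g v) (x ⊗ y) = f x * g y.
Proof.
rewrite tliftE // => [z|z] r u u'; rewrite linearP.
  by rewrite mulrDl scalerAl.
by rewrite mulrDr scalerAr.
Qed.

Lemma comatrix_antipodel I (m : I -> I -> H) i j : comatrix m ->
  \sum_r S (m i r) * m r j = (i == j)%:R *: 1.
Proof.
case=> mD me; rewrite -me -antipodel mD linear_sum; apply: eq_bigr => r _ /=.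
have -> : (fun u v => S u * v) = (fun u v => S u * (\1%VF : 'End(H)) v).
  by apply/funext => u; apply/funext=> v; rewrite id_lfunE.
by rewrite tlift_mulE id_lfunE.
Qed.

Lemma comatrix_antipoder I (m : I -> I -> H) i j : comatrix m ->
  \sum_r m i r * S (m r j) = (i == j)%:R *: 1.
Proof.
case=> mD me; rewrite -me -antipoder mD linear_sum; apply: eq_bigr => r _ /=.
have -> : (fun u v => u * S v) = (fun u v => (\1%VF : 'End(H)) u * S v).
  by apply/funext => u; apply/funext=> v; rewrite id_lfunE.
by rewrite tlift_mulE id_lfunE.
Qed.

Lemma comatrix_mul I J (m : I -> I -> H) (n : J -> J -> H) :
  comatrix m -> comatrix n ->
  comatrix (fun i j : I * J => m i.1 j.1 * n i.2 j.2).
Proof.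
move=> [mD me] [nD ne]; split=> [[i i'] [j j']|[i i'] [j j']] /=; last first.
  by rewrite counitM me ne -natrM mulnb xpair_eqE.
rewrite comulM mD nD tmul_suml.
rewrite (eq_bigr _ (fun r _ => linear_sum (@tmul k H _) _ _ _)) pair_big /=.
by apply: eq_bigr => -[r s] _; rewrite tmulE.
Qed.

Lemma antipode1 : S 1 = 1.
Proof.
have cm1 : comatrix (fun _ _ : unit => 1).
  split=> [] [] []; last by rewrite counit1.
  by rewrite comul1 big_const card_unit /= addr0.
have := comatrix_antipodel tt tt cm1.
by rewrite big_const card_unit /= addr0 mulr1 scale1r.
Qed.

Lemma mulr_linearl y : linear (fun x : H => x * y).
Proof. by move=> r u v; rewrite mulrDl scalerAl. Qed.

Lemma mulr_linearr x : linear (fun y : H => x * y).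
Proof. by move=> r u v; rewrite mulrDr scalerAr. Qed.

(** Both sides invert the Kronecker product of m and n: the left one by the antipode axiom, the
    right one by cancelling first n, then m. *)
Lemma antipode_comatrixM I J (m : I -> I -> H) (n : J -> J -> H) :
  comatrix m -> comatrix n ->
  forall i j i' j', S (m i j * n i' j') = S (n i' j') * S (m i j).
Proof.
move=> cm cn i j i' j'; have cmn := comatrix_mul cm cn.
apply: (@inverse_unique _ H *%R 1 _
  (fun s t : I * J => S (m s.1 t.1 * n s.2 t.2))
  (fun s t => m s.1 t.1 * n s.2 t.2)
  (fun s t => S (n s.2 t.2) * S (m s.1 t.1)) _ _ _ _ _ _ _ (i, i') (j, j')).
- exact: mulrA.
- exact: mul1r.
- exact: mulr1.
- exact: mulr_linearl.
- exact: mulr_linearr.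
- by move=> s t; apply: comatrix_antipodel cmn.
move=> [s s'] [t t'] /=; rewrite -(pair_big xpredT xpredT (fun r r' =>
  m s r * n s' r' * (S (n r' t') * S (m r t)))) /=.
have E r : \sum_r' m s r * n s' r' * (S (n r' t') * S (m r t)) =
    (s' == t')%:R *: (m s r * S (m r t)).
  transitivity (m s r * (\sum_r' n s' r' * S (n r' t')) * S (m r t)).
    by rewrite mulr_sumr mulr_suml; apply: eq_bigr => r' _; rewrite !mulrA.
  by rewrite comatrix_antipoder // -scalerAr -scalerAl mulr1.
rewrite (eq_bigr _ (fun r _ => E r)) -scaler_sumr comatrix_antipoder //.
by rewrite scalerA -natrM mulnb andbC xpair_eqE.
Qed.

Lemma antipodeM x y : S (x * y) = S y * S x.
Proof.
pose f1 : 'End(H) := (S \o amulr y)%VF; pose f2 : 'End(H) := (amull (S y) \o S)%VF.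
suff /(_ x) : f1 =1 f2 by rewrite !comp_lfunE !lfunE.
apply: (@comatrix_ext _ _ A) => I m cm i j; rewrite /f1 /f2 /= !comp_lfunE !lfunE /=.
pose g1 : 'End(H) := (S \o amull (m i j))%VF.
pose g2 : 'End(H) := (amulr (S (m i j)) \o S)%VF.
suff /(_ y) : g1 =1 g2 by rewrite !comp_lfunE !lfunE.
apply: (@comatrix_ext _ _ A) => J n cn i' j'; rewrite /g1 /g2 /= !comp_lfunE !lfunE /=.
exact: antipode_comatrixM.
Qed.

Lemma antipode_counit x : counit A (S x) = counit A x.
Proof.
rewrite -!epsE -comp_lfunE; move: x.
apply: (@comatrix_ext _ _ A _ (eps A \o S)%VF (eps A)) => I m cm i j.
rewrite /= comp_lfunE !epsE; have [_ me] := cm.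
have /(congr1 (counit A)) := comatrix_antipodel i j cm.
rewrite linear_sum linearZ /= counit1 mulr1 me => <-.
rewrite (bigD1 j) //= counitM me eqxx mulr1 big1 ?addr0 // => r /negPf rj.
by rewrite counitM me rj mulr0.
Qed.

(** Over H ⊗ H, the matrix Δ(m) has Δ(S(m)) as a left inverse and the right-hand side as a right
    inverse. *)
Lemma antipode_comatrixD I (m : I -> I -> H) i j : comatrix m ->
  comul A (S (m i j)) = \sum_r S (m r j) ⊗ S (m i r).
Proof.
move=> cm; have [mD me] := cm.
apply: (@inverse_unique _ _ (@tmul k H) (1 ⊗ 1) _
  (fun s t => comul A (S (m s t))) (fun s t => comul A (m s t))
  (fun s t => \sum_r S (m r t) ⊗ S (m s r))).
- exact: tmulA.
- exact: tmul1l.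
- exact: tmul1r.
- exact: tmul_linearl.
- exact: tmul_linearr.
- move=> s t; rewrite (eq_bigr _ (fun r _ => esym (comulM A _ _))) -linear_sum.
  by rewrite /= comatrix_antipodel // linearZ /= comul1.
move=> s t /=; have E r : tmul (comul A (m s r)) (\sum_u S (m u t) ⊗ S (m r u)) =
   \sum_v \sum_u (m s v * S (m u t)) ⊗ (m v r * S (m r u)).
  rewrite mD tmul_suml; apply: eq_bigr => v _.
  rewrite (linear_sum (@tmul k H (m s v ⊗ m v r))).
  by apply: eq_bigr => u _; rewrite /= tmulE.
rewrite (eq_bigr _ (fun r _ => E r)) exchange_big /=.
transitivity (\sum_v (m s v * S (m v t)) ⊗ (1 : H)).
  apply: eq_bigr => v _; rewrite exchange_big (bigD1 v) //=.
  rewrite -pure_sumr comatrix_antipoder // eqxx scale1r big1 ?addr0 // => u uv.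
  by rewrite -pure_sumr comatrix_antipoder // eq_sym (negPf uv) pureZr scale0r.
by rewrite -pure_suml comatrix_antipoder // pureZl.
Qed.

Lemma antipode_conv a b x :
  conv A a b (S x) = conv A (b \o S)%VF (a \o S)%VF x.
Proof.
rewrite -comp_lfunE; move: x.
apply: (@comatrix_ext _ _ A _ (conv A a b \o S)%VF (conv A _ _)) => I m cm i j.
have [mD me] := cm; rewrite /= comp_lfunE !convE antipode_comatrixD // mD.
rewrite !linear_sum; apply: eq_bigr => r _.
by rewrite /= !tpairE !comp_lfunE [RHS]mulrC.
Qed.

End Antipode.

(** * Injectivity of the antipode *)

Section AntipodeInjective.
Variables (k : fieldType) (H : falgType k) (A : hopf_algebra H).
Implicit Types (a b : 'Hom(H, k^o)) (x y : H) (I J : finType).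
Local Notation S := (antipode A).

Definition spow n : 'End(H) := iter n (fun f => S \o f)%VF \1%VF.

Arguments spow : simpl never.

Lemma spowS n x : spow n.+1 x = S (spow n x).
Proof. by rewrite /spow /= comp_lfunE. Qed.

Lemma spow0 x : spow 0 x = x. Proof. by rewrite /spow /= id_lfunE. Qed.

Lemma spowD m n x : spow (m + n) x = spow m (spow n x).
Proof. by elim: m => [|m IHm]; rewrite ?spow0 // addSn !spowS IHm. Qed.

Lemma spowSr n x : spow n.+1 x = spow n (S x).
Proof. by rewrite -addn1 spowD spowS spow0. Qed.

Lemma spow1 n : spow n 1 = 1.
Proof. by elim: n => [|n IHn]; rewrite ?spow0 // spowS IHn antipode1. Qed.

(** The product of H for even n and of the opposite algebra for odd n, so that the n-th power of S
    is multiplicative from H to it. *)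
Definition twist (n : nat) (x y : H) : H := if odd n then y * x else x * y.

Lemma spowM n x y : spow n (x * y) = twist n (spow n x) (spow n y).
Proof.
elim: n => [|n IHn]; rewrite ?spow0 // !spowS IHn /twist /=.
by case: odd; rewrite antipodeM.
Qed.

Lemma spow_conv_even n a b x :
  conv A a b (spow n.*2 x) = conv A (a \o spow n.*2)%VF (b \o spow n.*2)%VF x.
Proof.
have E e : (e \o spow 0 = e)%VF by rewrite comp_lfun1r.
elim: n a b => [|n IHn] a b; first by rewrite !E spow0.
rewrite doubleS !spowS !antipode_conv IHn; congr (conv A _ _ x).
  by apply/lfunP=> y; rewrite !comp_lfunE.
by apply/lfunP=> y; rewrite !comp_lfunE.
Qed.

Lemma spow_counit n x : counit A (spow n x) = counit A x.
Proof. by elim: n => [|n IHn]; rewrite ?spow0 // spowS antipode_counit. Qed.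

Lemma spow_morph_even n : coalg_morph A A (spow n.*2).
Proof.
split=> x; last exact: spow_counit.
by apply: tpair_ext => a b; rewrite tpair_tmap -!convE spow_conv_even.
Qed.

(** Fitting decomposition for F = S^(2m), with m > 0 chosen to make Ker F largest: then Ker F^2 =
    Ker F and H is the direct sum of Im F and Ker F. The exponent is even so that F, and with it the
    projection onto Im F along Ker F, is a coalgebra morphism. *)
Lemma fitting_projection :
  exists N, exists2 pi : 'End(H), coalg_morph A A pi &
    [/\ (0 < N)%N, forall x, spow N (pi x) = spow N x &
        forall x, spow N x = 0 -> pi x = 0].
Proof.
have [m m_gt0 maxm] : exists2 m, (0 < m)%N & forall i, (0 < i)%N ->
    (\dim (lker (spow i.*2)) <= \dim (lker (spow m.*2)))%N.
  pose P d := `[< exists2 m, (0 < m)%N & \dim (lker (spow m.*2)) = d >].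
  have exd : exists d, P d.
    by exists (\dim (lker (spow 1.*2))); apply/asboolP; exists 1%N.
  have ubd d : P d -> (d <= \dim {:H})%N.
    by case/asboolP=> m _ <-; apply: dimvS (subvf _).
  case: (ex_maxnP exd ubd) => _ /asboolP[m m_gt0 <-] maxm.
  by exists m => // i i_gt0; apply: maxm; apply/asboolP; exists i.
pose F := spow m.*2; have [FD Fe] : coalg_morph A A F := spow_morph_even m.
have kerF2 x : F (F x) = 0 -> F x = 0.
  have: (lker F == lker (spow (m + m).*2))%VS.
    rewrite eqEdim maxm ?addn_gt0 ?m_gt0 // andbT; apply/subvP=> y; rewrite !memv_ker => /eqP Fy.
    by rewrite doubleD spowD -/F Fy linear0.
  move/eqP=> kF FFx; apply/eqP; rewrite -memv_ker kF memv_ker doubleD spowD.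
  by rewrite -/F FFx.
pose B := limg F; pose K := lker F.
have BK0 : (B :&: K = 0)%VS.
  apply/eqP; rewrite -subv0; apply/subvP=> _ /memv_capP[/memv_imgP[y _ ->]].
  by rewrite memv_ker memv0 => /eqP/kerF2->.
have BKf : (B + K = fullv)%VS.
  apply/eqP; rewrite eqEdim subvf /= dimv_disjoint_sum //.
  by rewrite addnC -(limg_ker_dim F fullv) capfv.
pose pi := daddv_pi B K.
have Fpi x : F (pi x) = F x.
  have := daddv_pi_add BK0 (w := x); rewrite BKf memvf => /(_ isT) {2}<-.
  rewrite linearD /=; have: daddv_pi K B x \in K by apply: memv_pi.
  by rewrite memv_ker => /eqP->; rewrite addr0.
have piF x : pi (F x) = F x.
  by apply: daddv_pi_id => //; apply: memv_img; apply: memvf.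
have piK x : F x = 0 -> pi x = 0.
  move=> Fx0; apply/eqP; rewrite -memv0 -BK0 memv_cap memv_pi memv_ker Fpi.
  by rewrite Fx0 eqxx.
(* F + (1 - pi) is injective, hence invertible, and sends pi x to F x; its inverse serves as U. *)
have [U UF] : exists U : 'End(H), forall x, U (F x) = pi x.
  pose F' := (F + (\1 - pi))%VF.
  have F'E x : F' x = F x + (x - pi x).
    by rewrite !add_lfunE opp_lfunE id_lfunE.
  have F'K : lker F' == 0%VS.
    rewrite -subv0; apply/subvP=> x; rewrite memv_ker memv0 F'E => /eqP Fx.
    have Fx0 : F x = 0.
      apply: kerF2; have := congr1 F Fx; rewrite linear0 linearD linearB /=.
      by rewrite Fpi subrr addr0.
    by move/eqP: Fx; rewrite Fx0 piK // subr0 add0r.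
  exists F'^-1%VF => x; have <- : F' (pi x) = F x.
    by rewrite F'E Fpi (daddv_pi_proj _ BK0) subrr addr0.
  exact: lker0_lfunK.
exists m.*2; exists pi; last by rewrite double_gt0.
split=> x; last by rewrite -(Fe (pi x)) Fpi Fe.
(* Δ(pi x) lies in the image of F ⊗ F, so pi ⊗ pi = (U ⊗ U)(F ⊗ F) fixes it. Moving F through Δ and
   using F pi = F turns it into (pi ⊗ pi)Δ(x). *)
have ppF t : tmap pi pi (tmap F F t) = tmap F F t.
  by rewrite tmap_comp; congr (tmap _ _ t); apply/lfunP=> z; rewrite comp_lfunE piF.
have UUF t : tmap U U (tmap F F t) = tmap pi pi t.
  by rewrite tmap_comp; congr (tmap _ _ t); apply/lfunP=> z; rewrite comp_lfunE UF.
have /memv_imgP[y _ pxE] : pi x \in limg F by apply: memv_pi.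
have pD : comul A (pi x) = tmap pi pi (comul A (pi x)) by rewrite pxE FD ppF.
by rewrite pD -UUF -FD Fpi FD UUF.
Qed.

(* [spow n] and [spow n \o pi] are both convolution inverse to
   [spow n.+1 = spow n.+1 \o pi], so that the equality [spow N \o pi = spow N]
   descends to [pi = id]. *)
Lemma antipode_ker0 : lker S == 0%VS.
Proof.
have [N [pi pim [N_gt0 pN pK]]] := fitting_projection.
have down n : (forall x, spow n.+1 (pi x) = spow n.+1 x) ->
    forall x, spow n (pi x) = spow n x.
  move=> pn x; rewrite -comp_lfunE; move: x.
  apply: (@comatrix_ext _ _ A _ (spow n \o pi)%VF (spow n)) => I m cm i j /=.
  rewrite comp_lfunE; have cpm := comatrix_morph pim cm.
  apply: (@inverse_unique _ H (twist n) 1 _ (fun s t => spow n (pi (m s t)))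
    (fun s t => spow n.+1 (m s t)) (fun s t => spow n (m s t))).
  - by rewrite /twist => y z t; case: odd; rewrite mulrA.
  - by rewrite /twist => y; case: odd; rewrite (mul1r, mulr1).
  - by rewrite /twist => y; case: odd; rewrite (mul1r, mulr1).
  - rewrite /twist => y; case: odd.
      exact: mulr_linearr.
    exact: mulr_linearl.
  - rewrite /twist => y; case: odd.
      exact: mulr_linearl.
    exact: mulr_linearr.
  - move=> s t; rewrite -(spow1 n) -linearZ /= -(comatrix_antipoder s t cpm).
    rewrite linear_sum; apply: eq_bigr => r _ /=; rewrite spowM -pn.
    by rewrite spowSr.
  - move=> s t; rewrite -(spow1 n) -linearZ /= -(comatrix_antipodel s t cm).
    rewrite linear_sum; apply: eq_bigr => r _ /=; rewrite spowM.
    by rewrite spowSr.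
have pid x : pi x = x.
  have: forall n x, spow (N - n) (pi x) = spow (N - n) x.
    elim=> [|n IHn]; first by rewrite subn0.
    have [nN|nN] := leqP N n.
      by move: IHn; move: (nN); rewrite -subn_eq0 => /eqP->; rewrite (eqP (leqW nN)).
    by apply: down; rewrite subnSK.
  by move/(_ N x); rewrite subnn !spow0.
rewrite -subv0; apply/subvP=> x; rewrite memv_ker memv0 => /eqP Sx0.
rewrite -(pid x) pK // -(prednK N_gt0) spowSr Sx0.
by rewrite linear0.
Qed.
End AntipodeInjective.

(** * Invariance of the coradical *)

Section CoradicalStable.
Variables (k : fieldType) (V : vectType k) (c : coalgebra V) (f : 'End(V)).
Hypothesis f_inj : lker f == 0%VS.
Implicit Types (a b : 'Hom(V, k^o)) (x : V) (C D : {vspace V}).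

Let comp_invK a : ((a \o f^-1) \o f)%VF = a.
Proof. by apply/lfunP=> x; rewrite !comp_lfunE lker0_lfunK. Qed.

(** Images and preimages under the injective f match the subcoalgebras of C with those of its image,
    so f sends simple ones to simple ones. *)
Lemma coradical_image :
  (forall D, subcoalgebra c D -> subcoalgebra c (f @: D)) ->
  (forall D, subcoalgebra c D -> subcoalgebra c (f @^-1: D)) ->
  forall x, x \in coradical c -> f x \in coradical c.
Proof.
move=> fI fP x; rewrite memv_preim; move: x; apply/subvP.
apply: coradical_min => C [sC C0 minC]; apply/subvP=> x xC; rewrite -memv_preim.
apply: (subvP _ _ (memv_img f xC)); apply: simple_sub_coradical.
split; first exact: fI.
  by move/eqP; rewrite -dimv_eq0 limg_dim_eq ?dimv_eq0 ?(eqP f_inj) ?capv0 // => /eqP.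
move=> D sD DfC; have DE : D = (f @: (f @^-1: D))%VS.
  by rewrite lpreimK // (subv_trans DfC) // limgS ?subvf.
have DC : (f @^-1: D <= C)%VS.
  apply/subvP=> y; rewrite -memv_preim => /(subvP DfC)/memv_imgP[z zC].
  by move/(elimT lker0P f_inj) => ->.
case: (minC _ (fP _ sD) DC) => E; [left|right]; rewrite DE E //.
by rewrite limg0.
Qed.

Lemma coradical_morph :
  (forall a b x, conv c a b (f x) = conv c (a \o f)%VF (b \o f)%VF x) ->
  forall x, x \in coradical c -> f x \in coradical c.
Proof.
move=> fm; have rf a x : ract c a (f x) = f (ract c (a \o f)%VF x).
  apply: functional_ext => b.
  by rewrite -conv_ract fm conv_ract comp_lfunE.
have lf a x : lact c a (f x) = f (lact c (a \o f)%VF x).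
  apply: functional_ext => b.
  by rewrite -conv_lact fm conv_lact comp_lfunE.
apply: coradical_image => D /subcoalgebraP[rD lD]; apply/subcoalgebraP; split.
- by move=> a _ /memv_imgP[x xD ->]; rewrite rf memv_img ?rD.
- by move=> a _ /memv_imgP[x xD ->]; rewrite lf memv_img ?lD.
- by move=> a x; rewrite -!memv_preim => fx; rewrite -(comp_invK a) -rf rD.
- by move=> a x; rewrite -!memv_preim => fx; rewrite -(comp_invK a) -lf lD.
Qed.

Lemma coradical_antimorph :
  (forall a b x, conv c a b (f x) = conv c (b \o f)%VF (a \o f)%VF x) ->
  forall x, x \in coradical c -> f x \in coradical c.
Proof.
move=> fm; have rf a x : ract c a (f x) = f (lact c (a \o f)%VF x).
  apply: functional_ext => b.
  by rewrite -conv_ract fm conv_lact comp_lfunE.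
have lf a x : lact c a (f x) = f (ract c (a \o f)%VF x).
  apply: functional_ext => b.
  by rewrite -conv_lact fm conv_ract comp_lfunE.
apply: coradical_image => D /subcoalgebraP[rD lD]; apply/subcoalgebraP; split.
- by move=> a _ /memv_imgP[x xD ->]; rewrite rf memv_img ?lD.
- by move=> a _ /memv_imgP[x xD ->]; rewrite lf memv_img ?rD.
- by move=> a x; rewrite -!memv_preim => fx; rewrite -(comp_invK a) -lf lD.
- by move=> a x; rewrite -!memv_preim => fx; rewrite -(comp_invK a) -rf rD.
Qed.

(** f maps H_0 injectively into itself, hence onto itself by finite dimension. *)
Lemma coradical_preimage :
  (forall x, x \in coradical c -> f x \in coradical c) ->
  forall x, f x \in coradical c -> x \in coradical c.
Proof.
move=> fH x fx; have: (f @: coradical c == coradical c)%VS.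
  rewrite eqEdim limg_dim_eq ?(eqP f_inj) ?capv0 // leqnn andbT.
  by apply/subvP=> _ /memv_imgP[y yH ->]; apply: fH.
move/eqP=> fE; move: fx; rewrite -{1}fE => /memv_imgP[y yH].
by move/(elimT lker0P f_inj) => ->.
Qed.

End CoradicalStable.

Lemma grouplike_coradical (k : fieldType) (V : vectType k) (c : coalgebra V) g :
  grouplike c g -> g \in coradical c.
Proof.
case/andP=> /eqP gD /eqP ge; apply: (subvP (simple_sub_coradical (C := <[g]>%VS) _)).
  split.
  - rewrite /subcoalgebra limg_line gD -memvE; apply: mem_tensorv; exact: memv_line.
  - move=> g0; have: g \in <[g]>%VS by apply: memv_line.
    rewrite g0 memv0 => /eqP gg; move: ge; rewrite gg linear0 => /eqP.
    by rewrite eq_sym oner_eq0.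
  move=> D _ Dg; have [D0|nD0] := eqVneq (\dim D) 0%N.
    by left; apply/eqP; rewrite -dimv_eq0 D0.
  right; apply/eqP; rewrite eqEdim Dg dim_vline.
  by case: (g != 0) => //; rewrite lt0n.
exact: memv_line.
Qed.

(** * Grouplike elements and translations *)

Section GrouplikeGroup.
Variables (k : fieldType) (H : falgType k) (A : hopf_algebra H).
Implicit Types (a b : 'Hom(H, k^o)) (x y g h : H).
Local Notation S := (antipode A).

Lemma grouplike_mul g h :
  grouplike A g -> grouplike A h -> grouplike A (g * h).
Proof.
case/andP=> /eqP gD /eqP ge /andP[/eqP hD /eqP he].
by rewrite /grouplike comulM gD hD tmulE counitM ge he mulr1 !eqxx.
Qed.

Lemma grouplike1 : grouplike A 1.
Proof. by rewrite /grouplike comul1 counit1 !eqxx. Qed.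

Lemma grouplike_comatrix g : grouplike A g -> comatrix A (fun _ _ : unit => g).
Proof.
case/andP=> /eqP gD /eqP ge; split=> [] [] []; last by rewrite ge.
by rewrite gD big_const card_unit /= addr0.
Qed.

Lemma grouplike_mulVl g : grouplike A g -> S g * g = 1.
Proof.
move/grouplike_comatrix/(comatrix_antipodel tt tt).
by rewrite big_const card_unit /= addr0 scale1r.
Qed.

Lemma grouplike_antipode g : grouplike A g -> grouplike A (S g).
Proof.
move=> gg; rewrite /grouplike antipode_counit.
have := antipode_comatrixD tt tt (grouplike_comatrix gg).
rewrite big_const card_unit /= addr0 => ->.
by case/andP: gg => _ ->; rewrite eqxx.
Qed.

Lemma conv_translate g a b x : grouplike A g ->
  conv A a b (amull g x) = conv A (a \o amull g)%VF (b \o amull g)%VF x.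
Proof.
case/andP=> /eqP gD _; rewrite !convE -tpair_tmap [amull g x]lfunE /= comulM gD.
congr (tpair a b _); move: (comul A x) => t.
elim/tensor_pure_ind: t => [z s t Hs Ht||y z].
- by rewrite tmul_linearr Hs Ht linearP.
- by rewrite tmul0r linear0.
by rewrite tmulE tmapE !lfunE.
Qed.

Lemma translate_ker0 g : grouplike A g -> lker (amull g) == 0%VS.
Proof.
move=> gg; rewrite -subv0; apply/subvP=> x; rewrite memv_ker lfunE memv0 /=.
move/eqP/(congr1 (fun y => S g * y)).
by rewrite mulrA grouplike_mulVl // mul1r mulr0 => ->.
Qed.

Lemma coradical_translate g x : grouplike A g ->
  (g * x \in coradical A) = (x \in coradical A).
Proof.
move=> gg; have gH y : y \in coradical A -> amull g y \in coradical A.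
  apply: coradical_morph (translate_ker0 gg) _ _.
  by move=> *; apply: conv_translate.
have := coradical_preimage (translate_ker0 gg) gH (x := x).
have := gH x; rewrite lfunE /= => h1 h2.
by apply/idP/idP.
Qed.

Lemma coradical_antipode x : (S x \in coradical A) = (x \in coradical A).
Proof.
have SH y : y \in coradical A -> S y \in coradical A.
  apply: coradical_antimorph (antipode_ker0 A) _ _.
  by move=> *; apply: antipode_conv.
by apply/idP/idP; [apply: coradical_preimage (antipode_ker0 A) SH _ | apply: SH].
Qed.

End GrouplikeGroup.

(** * The lower bound *)

(** F_i is the identity on U_i and zero on the other U_j, so the sum of the U_i is direct. *)
Lemma eigenspaces_dim (k : fieldType) (V : vectType k) (I : finType)
    (U : I -> {vspace V}) (F : I -> 'End(V)) (X : {vspace V}) :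
  (forall i, (U i <= X)%VS) ->
  (forall i x, x \in U i -> F i x = x) ->
  (forall i j x, i != j -> x \in U i -> F j x = 0) ->
  (\sum_i \dim (U i) <= \dim X)%N.
Proof.
move=> UX Fid F0; have: directv (\sum_i U i).
  apply/directv_sum_independent => us Uus us0 i _.
  have := congr1 (F i) us0; rewrite linear0 linear_sum (bigD1 i) //= Fid ?Uus //.
  rewrite big1 ?addr0 // => j ji.
  by apply: (F0 j) => //; apply: Uus.
rewrite directvE /= => /eqP <-; apply: dimvS.
by apply/subv_sumP => i _.
Qed.

Section DualSystem.
Variables (k : fieldType) (V : vectType k) (c : coalgebra V).

(* The idempotents of the dual algebra cut out by [eps \o p], for a projection
   onto k[T] plus matrix coalgebras of sizes at least [m]: [Om t] is the
   functional dual to the grouplike [phi t], and [om s i j] that dual to the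
   matrix unit e_ij of the s-th matrix coalgebra. *)
Definition dual_system (p : 'End(V)) (T : finType) (phi : T -> V)
    (Om : T -> 'Hom(V, k^o)) (N : nat) (d : nat -> nat)
    (om : nat -> nat -> nat -> 'Hom(V, k^o)) (m : nat) : Prop :=
  [/\ forall t, grouplike c (phi t),
      forall t t', Om t (phi t') = (t == t')%:R,
      forall t, [/\ (Om t \o p)%VF = Om t,
        forall a, conv c (a \o p)%VF (Om t) = a (phi t) *: Om t &
        forall a, conv c (Om t) (a \o p)%VF = a (phi t) *: Om t],
      forall s, (s < N)%N -> [/\ (m <= d s)%N,
        forall i j, (om s i j \o p)%VF = om s i j &
        forall i j i' j', (i < d s)%N -> (j < d s)%N -> (i' < d s)%N ->
          (j' < d s)%N ->
          conv c (om s i j) (om s i' j') = (j == i')%:R *: om s i j'] &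
      eps c = \sum_t Om t + \sum_(s < N) \sum_(i < d s) om s i i].

End DualSystem.

(** * Elements of P_1 of grouplike type *)

Section Bounds.
Variables (k : fieldType) (H : falgType k) (A : hopf_algebra H) (p : 'End(H)).
Hypothesis p_proj : coalg_projection A (coradical A) p.
Hypothesis no_skew : ~ exists x : H, nontrivial_skew_primitive A x.
Implicit Types (a b : 'Hom(H, k^o)) (x y g h : H).
Local Notation S := (antipode A).
Local Notation conv := (conv A).
Local Notation lact := (lact A).
Local Notation ract := (ract A).
Local Notation eps := (eps A).
Local Notation H0 := (coradical A).
Local Notation q := (\1 - p)%VF.
Local Notation P := (P1 A p).

Let PP := P1P p_proj.

Lemma P1_conv x a b : x \in P -> vanish a H0 -> vanish b H0 -> conv a b x = 0.
Proof. by case/PP=> _; apply. Qed.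

Lemma P1_proj x : x \in P -> p x = 0.
Proof. by case/PP. Qed.

Lemma P1_convE a b x : x \in P ->
  conv a b x = conv (a \o p)%VF b x + conv a (b \o p)%VF x.
Proof.
rewrite mem_P1 => /eqP Dx; rewrite !convE {1}Dx linearD /= !tpair_tmap.
by rewrite !comp_lfun1r.
Qed.

(** Δ(x) lies in H_0 ⊗ I + I ⊗ H_0; a functional killing H_0 in the first factor sees only the
    second summand. *)
Lemma P1_conv_vanishl a b x : x \in P -> vanish a H0 ->
  conv a b x = conv a (b \o p)%VF x.
Proof.
move=> xP aH; rewrite P1_convE // (_ : (a \o p)%VF = 0) ?convE ?tpair_liftr.
  by rewrite zero_lfunE add0r.
by apply/lfunP=> y; rewrite comp_lfunE zero_lfunE aH //; apply: proj_in.
Qed.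

Lemma P1_conv_vanishr a b x : x \in P -> vanish b H0 ->
  conv a b x = conv (a \o p)%VF b x.
Proof.
move=> xP bH; rewrite P1_convE // (_ : (b \o p)%VF = 0) ?[X in _ + X]convE.
  by rewrite tpair_lift zero_lfunE addr0.
by apply/lfunP=> y; rewrite comp_lfunE zero_lfunE bH //; apply: proj_in.
Qed.

Lemma vanish_convr a b : vanish b H0 -> vanish (conv a b) H0.
Proof. by move=> bH x xH; rewrite conv_lact bH //; apply: coradical_lstable. Qed.

Lemma vanish_convl a b : vanish a H0 -> vanish (conv a b) H0.
Proof. by move=> aH x xH; rewrite conv_ract aH //; apply: coradical_rstable. Qed.

Lemma P1_ract a x : x \in P -> ract (a \o p)%VF x \in P.
Proof.
move=> xP; apply/PP; split=> [|b e bH eH].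
  apply: functional_ext => b; rewrite linear0 -comp_lfunE -conv_ract.
  by rewrite (proj_conv p_proj) comp_lfunE P1_proj // linear0.
by rewrite -conv_ract -convA P1_conv //; apply: vanish_convl.
Qed.

Lemma P1_lact a x : x \in P -> lact (a \o p)%VF x \in P.
Proof.
move=> xP; apply/PP; split=> [|b e bH eH].
  apply: functional_ext => b; rewrite linear0 -comp_lfunE -conv_lact.
  by rewrite (proj_conv p_proj) comp_lfunE P1_proj // linear0.
by rewrite -conv_lact convA P1_conv //; apply: vanish_convr.
Qed.

(** Paired form of ρ_R(x) = x ⊗ h; [left_type] likewise encodes ρ_L(x) = h ⊗ x. *)
Definition right_type h x := forall a b, conv a (b \o p)%VF x = a x * b h.
Definition left_type h x := forall a b, conv (a \o p)%VF b x = a h * b x.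

(** Both types together give Δ(x) = g ⊗ x + x ⊗ h. Such an x is skew primitive, so it lies in k[G]
    inside H_0, which meets I in 0. *)
Lemma two_sided_type g h x : grouplike A g -> grouplike A h -> x \in P ->
  left_type g x -> right_type h x -> x = 0.
Proof.
move=> gg gh xP lx rx; case: (pselect (x \in <<grouplikes A>>%VS)) => [xG|xG].
  suff xH : x \in H0 by rewrite -(proj_id p_proj xH) P1_proj.
  apply: (subvP _ _ xG); apply/span_subvP => y yG; apply: grouplike_coradical.
  by rewrite -in_grouplikes.
case: no_skew; exists x; split; last exact/negP.
exists g, h; split=> //; apply: tpair_ext => a b.
by rewrite -convE P1_convE // lx rx linearD /= !tpairE.
Qed.

Lemma qP1 (f : 'End(H)) x :
  (forall a b, vanish a H0 -> vanish b H0 -> conv a b (f x) = 0) ->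
  q (f x) \in P.
Proof.
move=> fx; apply/PP; split=> [|a b aH bH].
  by rewrite qE linearB /= (projK p_proj) subrr.
rewrite qE linearB /= fx // -[conv a b (p _)]comp_lfunE -(proj_conv p_proj).
rewrite conv_ract comp_lfunE aH ?subr0 //; exact: (proj_in p_proj).
Qed.

(** Paired form of (p ⊗ id)Δq = (p ⊗ q)Δ, which follows from Δp = (p ⊗ p)Δ. *)
Lemma q_conv_l a b z : conv (b \o p)%VF a (q z) = conv (b \o p)%VF (a \o q)%VF z.
Proof.
rewrite qE linearB /= -[conv _ _ (p z)]comp_lfunE -(proj_conv p_proj).
have -> : ((b \o p) \o p)%VF = (b \o p)%VF.
  by apply/lfunP=> y; rewrite !comp_lfunE (projK p_proj).
apply/eqP; rewrite subr_eq addrC -add_lfunE -[conv _ (a \o p)%VF]scale1r -convDr.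
by rewrite scale1r -comp_split.
Qed.

Lemma q_conv_r a b z : conv a (b \o p)%VF (q z) = conv (a \o q)%VF (b \o p)%VF z.
Proof.
rewrite qE linearB /= -[conv _ _ (p z)]comp_lfunE -(proj_conv p_proj).
have -> : ((b \o p) \o p)%VF = (b \o p)%VF.
  by apply/lfunP=> y; rewrite !comp_lfunE (projK p_proj).
apply/eqP; rewrite subr_eq addrC -add_lfunE -[conv (a \o p)%VF _]scale1r -convDl.
by rewrite scale1r -comp_split.
Qed.

Lemma q_inj (f : 'End(H)) x : (forall y, (f y \in H0) = (y \in H0)) ->
  x \in P -> q (f x) = 0 -> x = 0.
Proof.
move=> fH xP /eqP; rewrite qE subr_eq0 => /eqP fx.
have xH : x \in H0 by rewrite -fH fx; apply: (proj_in p_proj).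
by rewrite -(proj_id p_proj xH) P1_proj.
Qed.

Lemma vanish_comp (f : 'End(H)) a : (forall y, (f y \in H0) = (y \in H0)) ->
  vanish a H0 -> vanish (a \o f)%VF H0.
Proof. by move=> fH aH x xH; rewrite comp_lfunE aH // fH. Qed.

Lemma translate_H0 g : grouplike A g ->
  forall y, (amull g y \in H0) = (y \in H0).
Proof. by move=> gg y; rewrite lfunE /= coradical_translate. Qed.

Lemma translate_P1 g x : grouplike A g -> x \in P -> q (amull g x) \in P.
Proof.
move=> gg xP; apply: qP1 => a b aH bH; rewrite conv_translate //.
by apply: P1_conv => //; apply: vanish_comp => //; apply: translate_H0.
Qed.

Lemma grouplike_proj g : grouplike A g -> p g = g.
Proof. by move=> gg; apply: (proj_id p_proj); apply: grouplike_coradical. Qed.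

(** The map q(g x) is the action of G on P_1. Since Δ(g x) = (g ⊗ g)Δ(x), it multiplies types by
    g. *)
Lemma translate_right g h x : grouplike A g -> grouplike A h -> x \in P ->
  right_type h x -> right_type (g * h) (q (amull g x)).
Proof.
move=> gg gh xP rx a b; rewrite q_conv_r conv_translate //.
rewrite P1_conv_vanishl // ?rx.
  by rewrite !comp_lfunE [amull g h]lfunE /= grouplike_proj ?grouplike_mul.
by apply: vanish_comp (vanishq p_proj _); apply: translate_H0.
Qed.

Lemma translate_left g h x : grouplike A g -> grouplike A h -> x \in P ->
  left_type h x -> left_type (g * h) (q (amull g x)).
Proof.
move=> gg gh xP lx a b; rewrite q_conv_l conv_translate //.
rewrite P1_conv_vanishr // ?lx.
  by rewrite !comp_lfunE [amull g h]lfunE /= grouplike_proj ?grouplike_mul.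
by apply: vanish_comp (vanishq p_proj _); apply: translate_H0.
Qed.

Lemma antipode_P1 x : x \in P -> q (S x) \in P.
Proof.
move=> xP; apply: qP1 => a b aH bH; rewrite antipode_conv.
by apply: P1_conv => //; apply: vanish_comp => // y; apply: coradical_antipode.
Qed.

(** S reverses coproducts, so it exchanges the two sides and inverts the type. *)
Lemma antipode_right h x : grouplike A h -> x \in P ->
  right_type h x -> left_type (S h) (q (S x)).
Proof.
move=> gh xP rx a b; rewrite q_conv_l antipode_conv P1_conv_vanishl // ?rx.
  by rewrite !comp_lfunE grouplike_proj ?grouplike_antipode // mulrC.
by apply: vanish_comp (vanishq p_proj _) => y; apply: coradical_antipode.
Qed.

Lemma antipode_left h x : grouplike A h -> x \in P ->
  left_type h x -> right_type (S h) (q (S x)).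
Proof.
move=> gh xP lx a b; rewrite q_conv_r antipode_conv P1_conv_vanishr // ?lx.
  by rewrite !comp_lfunE grouplike_proj ?grouplike_antipode // mulrC.
by apply: vanish_comp (vanishq p_proj _) => y; apply: coradical_antipode.
Qed.

(** * Decomposition of P_1 by the dual idempotents *)

Variables (T : finType) (phi : T -> H) (Om : T -> 'Hom(H, k^o)).
Variables (N m : nat) (d : nat -> nat) (om : nat -> nat -> nat -> 'Hom(H, k^o)).
Hypothesis dual : dual_system A p phi Om N d om m.

Let phiG t : grouplike A (phi t). Proof. by case: dual. Qed.
Let Om_phi t t' : Om t (phi t') = (t == t')%:R. Proof. by case: dual. Qed.
Let Omp t : (Om t \o p)%VF = Om t.
Proof. by case: dual => _ _ /(_ t)[]. Qed.
Let conv_Om a t : conv (a \o p)%VF (Om t) = a (phi t) *: Om t.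
Proof. by case: dual => _ _ /(_ t)[]. Qed.
Let Om_conv a t : conv (Om t) (a \o p)%VF = a (phi t) *: Om t.
Proof. by case: dual => _ _ /(_ t)[]. Qed.
Let size_om s : (s < N)%N -> (m <= d s)%N.
Proof. by case: dual => _ _ _ + _ => /(_ s) + sN => /(_ sN)[]. Qed.
Let omp s i j : (s < N)%N -> (om s i j \o p)%VF = om s i j.
Proof. by move=> sN; case: dual => _ _ _ /(_ s sN)[_ -> _] _. Qed.
Let om_conv s i j i' j' : (s < N)%N -> (i < d s)%N -> (j < d s)%N ->
  (i' < d s)%N -> (j' < d s)%N ->
  conv (om s i j) (om s i' j') = (j == i')%:R *: om s i j'.
Proof. by move=> sN; case: dual => _ _ _ /(_ s sN)[_ _ +] _; apply. Qed.
Let epsE : eps = \sum_t Om t + \sum_(s < N) \sum_(i < d s) om s i i.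
Proof. by case: dual. Qed.

(** [Om t] spans an ideal of the embedded dual of H_0, on which a ∘ p acts by the scalar
    a([phi t]). *)
Lemma ract_Om_right t x : right_type (phi t) (ract (Om t) x).
Proof.
move=> a b; rewrite conv_ract ract_ract conv_Om linearZ scale_lfunE.
by rewrite linearZ /= [LHS]mulrC.
Qed.

Lemma lact_Om_left t x : left_type (phi t) (lact (Om t) x).
Proof.
by move=> a b; rewrite conv_lact lact_lact Om_conv linearZ scale_lfunE linearZ.
Qed.

Lemma right_type_ract t t' x :
  right_type (phi t) x -> ract (Om t') x = (t' == t)%:R *: x.
Proof.
move=> rx; apply: functional_ext => a.
by rewrite -conv_ract -Omp rx Om_phi linearZ /= mulrC.
Qed.

Lemma left_type_lact t t' x :
  left_type (phi t) x -> lact (Om t') x = (t' == t)%:R *: x.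
Proof.
move=> lx; apply: functional_ext => a.
by rewrite -conv_lact -Omp lx Om_phi linearZ.
Qed.

(** The elements of P_1 of right type [phi t], cut out as the fixed space of the idempotent
    [ract (Om t)]. *)
Definition right_space t := (P :&: lker (ract (Om t) - \1)%VF)%VS.
Definition left_space t := (P :&: lker (lact (Om t) - \1)%VF)%VS.

Lemma right_spaceP t x :
  reflect (x \in P /\ right_type (phi t) x) (x \in right_space t).
Proof.
rewrite memv_cap memv_ker add_lfunE opp_lfunE id_lfunE subr_eq0.
apply: (iffP andP) => [[xP /eqP <-]|[xP rx]].
  by split; [rewrite -Omp P1_ract | apply: ract_Om_right].
by split=> //; rewrite (right_type_ract _ rx) eqxx scale1r.
Qed.

Lemma left_spaceP t x :
  reflect (x \in P /\ left_type (phi t) x) (x \in left_space t).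
Proof.
rewrite memv_cap memv_ker add_lfunE opp_lfunE id_lfunE subr_eq0.
apply: (iffP andP) => [[xP /eqP <-]|[xP rx]].
  by split; [rewrite -Omp P1_lact | apply: lact_Om_left].
by split=> //; rewrite (left_type_lact _ rx) eqxx scale1r.
Qed.

Lemma lact_decomp x : x =
  \sum_t lact (Om t) x + \sum_(s < N) \sum_(i < d s) lact (om s i i) x.
Proof.
rewrite -[LHS](lact_eps A) epsE linearD add_lfunE; congr (_ + _).
  by rewrite linear_sum sum_lfunE.
rewrite linear_sum sum_lfunE; apply: eq_bigr => s _.
by rewrite linear_sum sum_lfunE.
Qed.

Lemma ract_decomp x : x =
  \sum_t ract (Om t) x + \sum_(s < N) \sum_(i < d s) ract (om s i i) x.
Proof.
rewrite -[LHS](ract_eps A) epsE linearD add_lfunE; congr (_ + _).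
  by rewrite linear_sum sum_lfunE.
rewrite linear_sum sum_lfunE; apply: eq_bigr => s _.
by rewrite linear_sum sum_lfunE.
Qed.

Lemma lact_block x : x != 0 -> (forall t, lact (Om t) x = 0) ->
  exists s i, [/\ (s < N)%N, (i < d s)%N & lact (om s i i) x != 0].
Proof.
move=> + Om0; apply: contraPP => no; apply/negP; rewrite negbK.
rewrite (lact_decomp x) big1 // add0r big1 // => s _; rewrite big1 // => i _.
by apply/eqP/negPn/negP => nz; apply: no; exists s, i.
Qed.

Lemma ract_block x : x != 0 -> (forall t, ract (Om t) x = 0) ->
  exists s i, [/\ (s < N)%N, (i < d s)%N & ract (om s i i) x != 0].
Proof.
move=> + Om0; apply: contraPP => no; apply/negP; rewrite negbK.
rewrite (ract_decomp x) big1 // add0r big1 // => s _; rewrite big1 // => i _.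
by apply/eqP/negPn/negP => nz; apply: no; exists s, i.
Qed.

(** The matrix units [om s i j] move the nonzero component of x to vectors y_j. These are nonzero,
    as [om s j i] returns y_j to y_i, and independent, as the [om s j j] separate them. *)
Lemma lact_block_dim s i x (X : {vspace H}) : (s < N)%N -> (i < d s)%N ->
  lact (om s i i) x != 0 -> (forall j, lact (om s i j) x \in X) ->
  (m <= \dim X)%N.
Proof.
move=> sN id nz xX; apply: leq_trans (size_om sN) _.
pose y j := lact (om s i j) x.
have E j l l' : (j < d s)%N -> (l < d s)%N -> (l' < d s)%N ->
    lact (om s l l') (y j) = (j == l)%:R *: y l'.
  move=> *; rewrite /y lact_lact om_conv // linearZ scale_lfunE.
  by [].
have := @eigenspaces_dim _ _ 'I_(d s) (fun j => <[y j]>%VS)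
  (fun j => lact (om s j j)) X; rewrite (eq_bigr (fun _ => 1%N)).
  rewrite sum1_card card_ord; apply.
  - by move=> j; rewrite -memvE; apply: xX.
  - by move=> j _ /vlineP[r ->]; rewrite linearZ /= E // eqxx scale1r.
  move=> j l _ jl /vlineP[r ->]; rewrite linearZ /= E //.
  by rewrite (inj_eq val_inj) (negPf jl) scale0r scaler0.
move=> j _; rewrite dim_vline; suff -> : y j != 0 by [].
apply: contraNneq nz => yj0; rewrite -/(y i).
have := E j j i (ltn_ord j) (ltn_ord j) id.
by rewrite yj0 linear0 eqxx scale1r => <-.
Qed.

Lemma ract_block_dim s i x (X : {vspace H}) : (s < N)%N -> (i < d s)%N ->
  ract (om s i i) x != 0 -> (forall j, ract (om s j i) x \in X) ->
  (m <= \dim X)%N.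
Proof.
move=> sN id nz xX; apply: leq_trans (size_om sN) _.
pose y j := ract (om s j i) x.
have E j l l' : (j < d s)%N -> (l < d s)%N -> (l' < d s)%N ->
    ract (om s l' l) (y j) = (l == j)%:R *: y l'.
  move=> *; rewrite /y ract_ract om_conv // linearZ scale_lfunE.
  by [].
have := @eigenspaces_dim _ _ 'I_(d s) (fun j => <[y j]>%VS)
  (fun j => ract (om s j j)) X; rewrite (eq_bigr (fun _ => 1%N)).
  rewrite sum1_card card_ord; apply.
  - by move=> j; rewrite -memvE; apply: xX.
  - by move=> j _ /vlineP[r ->]; rewrite linearZ /= E // eqxx scale1r.
  move=> j l _ jl /vlineP[r ->]; rewrite linearZ /= E //.
  by rewrite (inj_eq val_inj) eq_sym (negPf jl) scale0r scaler0.
move=> j _; rewrite dim_vline; suff -> : y j != 0 by [].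
apply: contraNneq nz => yj0; rewrite -/(y i).
have := E j j i (ltn_ord j) (ltn_ord j) id.
by rewrite yj0 linear0 eqxx scale1r => <-.
Qed.

Lemma right_space_lact t a x : x \in right_space t ->
  lact (a \o p)%VF x \in right_space t.
Proof.
case/right_spaceP=> xP rx; apply/right_spaceP; split; first exact: P1_lact.
move=> b e; rewrite conv_ract -lact_ract -!conv_lact.
by rewrite -conv_ract rx.
Qed.

Lemma left_space_ract t a x : x \in left_space t ->
  ract (a \o p)%VF x \in left_space t.
Proof.
case/left_spaceP=> xP lx; apply/left_spaceP; split; first exact: P1_ract.
move=> b e; rewrite conv_lact lact_ract -!conv_ract.
by rewrite -conv_lact lx.
Qed.

(** For x in this space, [lact (Om t') x] has grouplike types on both sides and so vanishes. Some
    matrix block must then act nontrivially from the left, and it preserves the space. *)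
Lemma right_space_dim t : right_space t != 0%VS -> (m <= \dim (right_space t))%N.
Proof.
move=> nz; have [||s [i [sN id nzi]]] := @lact_block (vpick (right_space t)).
- by rewrite vpick0.
- move=> t'; have xR := memv_pick (right_space t).
  move: (right_space_lact (Om t') xR); rewrite Omp => /right_spaceP[yP ry].
  apply: (two_sided_type (phiG t') (phiG t)) => //; exact: lact_Om_left.
apply: (lact_block_dim sN id nzi) => j; rewrite -omp //.
by apply: right_space_lact; apply: memv_pick.
Qed.

Lemma left_space_dim t : left_space t != 0%VS -> (m <= \dim (left_space t))%N.
Proof.
move=> nz; have [||s [i [sN id nzi]]] := @ract_block (vpick (left_space t)).
- by rewrite vpick0.
- move=> t'; have xR := memv_pick (left_space t).
  move: (left_space_ract (Om t') xR); rewrite Omp => /left_spaceP[yP ly].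
  apply: (two_sided_type (phiG t) (phiG t')) => //; exact: ract_Om_right.
apply: (ract_block_dim sN id nzi) => j; rewrite -omp //.
by apply: left_space_ract; apply: memv_pick.
Qed.

Lemma right_spaces_nonzero h x t : grouplike A h -> x \in P -> x != 0 ->
  right_type h x -> right_space t != 0%VS.
Proof.
move=> gh xP x0 rx; have gSh := grouplike_antipode gh.
(* S h is the inverse of h, so translation by g turns type h into type [phi t]. *)
pose g := phi t * S h; have gg : grouplike A g by apply: grouplike_mul.
apply: contra_neq x0 => R0; apply: (q_inj (translate_H0 gg) xP).
apply/eqP; rewrite -memv0 -R0; apply/right_spaceP.
split; first exact: translate_P1.
have -> : phi t = g * h by rewrite /g -mulrA grouplike_mulVl // mulr1.
exact: translate_right.
Qed.

Lemma left_spaces_nonzero h x t : grouplike A h -> x \in P -> x != 0 ->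
  left_type h x -> left_space t != 0%VS.
Proof.
move=> gh xP x0 rx; have gSh := grouplike_antipode gh.
pose g := phi t * S h; have gg : grouplike A g by apply: grouplike_mul.
apply: contra_neq x0 => R0; apply: (q_inj (translate_H0 gg) xP).
apply/eqP; rewrite -memv0 -R0; apply/left_spaceP.
split; first exact: translate_P1.
have -> : phi t = g * h by rewrite /g -mulrA grouplike_mulVl // mulr1.
exact: translate_left.
Qed.

Lemma one_sided_bound h x : grouplike A h -> x \in P -> x != 0 ->
  right_type h x \/ left_type h x -> (2 * m * #|T| <= \dim P)%N.
Proof.
move=> gh xP x0 typ.
have nz t : right_space t != 0%VS /\ left_space t != 0%VS.
  have Sx0 : q (S x) != 0.
    by apply: contra_neq x0; apply: q_inj => // y; apply: coradical_antipode.
  have SP := antipode_P1 xP; have gSh := grouplike_antipode gh.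
  case: typ => typ; split.
  - exact: right_spaces_nonzero typ.
  - by apply: left_spaces_nonzero (antipode_right _ _ typ).
  - by apply: right_spaces_nonzero (antipode_left _ _ typ).
  - exact: left_spaces_nonzero typ.
(* One copy of T indexes right types, the other left types: 2|G| subspaces. The idempotents of one
   side kill the subspaces of the other, since the result would be of two-sided type. *)
pose U (i : T + T) := match i with inl t => right_space t | inr t => left_space t end.
pose F (i : T + T) := match i with inl t => ract (Om t) | inr t => lact (Om t) end.
apply: (@leq_trans (\sum_i \dim (U i))).
  rewrite -mulnA mulnCA mul2n -addnn -card_sum mulnC -sum_nat_const.
  apply: leq_sum => -[t|t] _ /=; have [rz lz] := nz t.
    exact: right_space_dim.
  exact: left_space_dim.
have mixed t t' x' : x' \in right_space t -> lact (Om t') x' = 0.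
  move=> xR; have := right_space_lact (Om t') xR; rewrite Omp.
  case/right_spaceP=> yP ry.
  by apply: (two_sided_type (phiG t') (phiG t)) => //; apply: lact_Om_left.
have mixed' t t' x' : x' \in left_space t -> ract (Om t') x' = 0.
  move=> xR; have := left_space_ract (Om t') xR; rewrite Omp.
  case/left_spaceP=> yP ly.
  by apply: (two_sided_type (phiG t) (phiG t')) => //; apply: ract_Om_right.
apply: (@eigenspaces_dim _ _ _ U F).
- by case=> t; apply: capvSl.
- by case=> t y; [case/right_spaceP=> _ /right_type_ract|case/left_spaceP=> _ /left_type_lact];
    move=> /= ->; rewrite eqxx scale1r.
case=> t [] t' y tt' /=.
- case/right_spaceP=> _ /right_type_ract->.
  by have /negPf-> : t' != t by [rewrite eq_sym]; rewrite scale0r.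
- exact: mixed.
- exact: mixed'.
case/left_spaceP=> _ /left_type_lact->.
by have /negPf-> : t' != t by [rewrite eq_sym]; rewrite scale0r.
Qed.

(** With no grouplike components, a nonzero x has a nonzero component in some matrix block on the
    left, and this again in some block on the right. Matrix units on both sides then spread it to
    d_s d_s' independent vectors. *)
Lemma two_sided_bound : P != 0%VS ->
  (forall t x, x \in P -> right_type (phi t) x -> x = 0) ->
  (forall t x, x \in P -> left_type (phi t) x -> x = 0) ->
  (m ^ 2 <= \dim P)%N.
Proof.
move=> P0 noR noL; have [||s [i [sN id nzi]]] := @lact_block (vpick P).
- by rewrite vpick0.
- move=> t; apply: (noL t); last exact: lact_Om_left.
  by rewrite -Omp P1_lact ?memv_pick.
have yP : lact (om s i i) (vpick P) \in P by rewrite -omp // P1_lact ?memv_pick.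
have [|s' [i' [sN' id' nzi']]] := ract_block nzi.
  move=> t; apply: (noR t); last exact: ract_Om_right.
  by rewrite -Omp P1_ract.
pose z (jl : 'I_(d s) * 'I_(d s')) :=
  lact (om s i jl.1) (ract (om s' jl.2 i') (vpick P)).
pose F (jl : 'I_(d s) * 'I_(d s')) :=
  (lact (om s jl.1 jl.1) \o ract (om s' jl.2 jl.2))%VF.
have E jl j l j' l' : (j < d s)%N -> (l < d s)%N -> (j' < d s')%N ->
    (l' < d s')%N ->
    lact (om s l j) (ract (om s' j' l') (z jl)) =
    ((jl.1 == l :> nat) && (l' == jl.2))%:R *:
      lact (om s i j) (ract (om s' j' i') (vpick P)).
  move=> *; rewrite /z -lact_ract lact_lact ract_ract !om_conv //.
  by rewrite !linearZ !scale_lfunE linearZ /= scalerA -natrM mulnb.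
(* The units [om s jl.1 i] and [om s' i' jl.2] send z back to the nonzero starting component. *)
have z0 jl : z jl != 0.
  apply: contraNneq nzi' => zjl0.
  have := E jl i jl.1 i' jl.2 id (ltn_ord _) id' (ltn_ord _).
  by rewrite zjl0 !linear0 !eqxx scale1r lact_ract => <-.
have zP jl : z jl \in P by rewrite /z -omp // P1_lact // -omp // P1_ract ?memv_pick.
have := @eigenspaces_dim _ _ _ (fun jl => <[z jl]>%VS) F P.
rewrite (eq_bigr (fun _ => 1%N)) => [|jl _]; last by rewrite dim_vline z0.
rewrite sum1_card card_prod !card_ord => zdim.
apply: (@leq_trans (d s * d s')); first by rewrite -mulnn leq_mul ?size_om.
apply: zdim => [jl|jl _ /vlineP[r ->]|jl jl' _ jj /vlineP[r ->]].
- by rewrite -memvE.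
- by rewrite linearZ /F /= comp_lfunE E // !eqxx scale1r.
rewrite linearZ /F /= comp_lfunE E // [(_ == _) && _](_ : _ = false).
  by rewrite scale0r scaler0.
apply: contraNF jj => /andP[/eqP e1 /eqP e2].
by apply/eqP; case: jl jl' e1 e2 => [? ?] [? ?] /= /val_inj-> /esym/val_inj->.
Qed.

Lemma P1_bound : P != 0%VS -> (minn (m ^ 2) (2 * m * #|T|) <= \dim P)%N.
Proof.
move=> P0; rewrite geq_min.
case: (pselect (exists t x, [/\ x \in P, x != 0 &
    right_type (phi t) x \/ left_type (phi t) x])) => [|no].
  by case=> t [x [xP x0 tx]]; rewrite (one_sided_bound (phiG t) xP x0 tx) orbT.
apply/orP; left; apply: two_sided_bound => // t x xP tx;
  by apply/eqP/negPn/negP => x0; apply: no; exists t, x; split=> //; tauto.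
Qed.

End Bounds.

(** * Divisibility *)

Section RootsOfUnity.
Variable k : closedFieldType.
Hypothesis char0 : [pchar k] =i pred0.

Lemma natr_eq0_char0 n : (n%:R == 0 :> k) = (n == 0)%N.
Proof. exact: (iffLR (pcharf0P k)). Qed.

Lemma natr_inj_char0 m n : m%:R = n%:R :> k -> m = n.
Proof.
wlog le_mn : m n / (m <= n)%N => [IH|/esym/eqP].
  by case/orP: (leq_total m n) => /IH // IHnm /esym/IHnm.
rewrite -subr_eq0 -natrB // natr_eq0_char0 subn_eq0 => le_nm.
by apply/eqP; rewrite eqn_leq le_mn.
Qed.

Lemma intr_eq0_char0 (n : int) : (n%:~R == 0 :> k) = (n == 0).
Proof.
case: n => n; first by rewrite -pmulrn natr_eq0_char0.
by rewrite NegzE rmorphN /= -pmulrn oppr_eq0 natr_eq0_char0.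
Qed.

Lemma prim_root_exists n : (0 < n)%N -> exists z : k, n.-primitive_root z.
Proof.
move=> n_gt0; have n0 : n%:R != 0 :> k by rewrite natr_eq0_char0 -lt0n.
have [r Dp] := closed_field_poly_normal ('X^n - 1 : {poly k}).
rewrite (monicP _) ?monicXnsubC // scale1r in Dp.
have rn1: all n.-unity_root r by apply/allP=> z; rewrite -root_prod_XsubC -Dp.
have sz_r: (n < (size r).+1)%N.
  by rewrite -(size_prod_XsubC r id) -Dp size_XnsubC.
have [|z] := hasP (has_prim_root n_gt0 rn1 _ sz_r); last by exists z.
by rewrite -separable_prod_XsubC -Dp separable_Xn_sub_1.
Qed.

Local Notation pZtok := (map_poly (intr : int -> k)).
Local Notation pZtoC := (map_poly (intr : int -> algC)).

(* An integral relation satisfied by a root of 'Phi_d in k also holds for the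
   primitive roots in algC, by irreducibility of 'Phi_d. *)
Lemma transfer_root (f : {poly int}) d (zk : k) (z : algC) :
  root (pZtok 'Phi_d) zk -> d.-primitive_root z ->
  root (pZtok f) zk -> root (pZtoC f) z.
Proof.
move=> Phizk prim_z fzk; have PhiC := Cintr_Cyclotomic prim_z.
have mPhi := Cyclotomic_monic d.
have ncop : ~~ coprimep f 'Phi_d.
  apply/negP=> /Bezout_coprimepP[[u v]] /eqpP[[c1 c2] /= /andP[_ c2n0] e].
  have := congr1 (fun q => (pZtok q).[zk]) e.
  rewrite /= !map_polyZ rmorphD !rmorphM /= !hornerZ hornerD !hornerM.
  rewrite (rootP Phizk) (rootP fzk) !mulr0 addr0 mulr0 rmorph1 hornerC mulr1.
  by move/esym/eqP; rewrite intr_eq0_char0 (negPf c2n0).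
pose g := gcdp f 'Phi_d.
have gs : size g != 1%N by [].
have [[cf qf] /= cf0 fE] := Pdiv.Idomain.dvdpP _ _ (dvdp_gcdl f 'Phi_d).
have [[cP h] /= cP0 PE] := Pdiv.Idomain.dvdpP _ _ (dvdp_gcdr f 'Phi_d).
have Phi0 : 'Phi_d != 0 by apply: monic_neq0.
have cPPhi : cP *: 'Phi_d != 0 by rewrite scale_poly_eq0 negb_or cP0.
have hn0 : h != 0 by apply: contraNneq cPPhi => h0; rewrite PE h0 mul0r.
have gn0 : g != 0 by apply: contraNneq cPPhi => g0; rewrite PE -/g g0 mulr0.
have sz : (size h < size 'Phi_d)%N.
  rewrite -(size_scale 'Phi_d cP0) PE size_mul // -/g.
  have: (1 < size g)%N by rewrite ltn_neqAle eq_sym gs size_poly_gt0.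
  by case: (size g) => [|[|s]] // _; rewrite addnS /= addnS ltnS leq_addr.
(* z is a root of g or of the cofactor h; the latter has smaller degree than 'Phi_d, the minimal
   polynomial of z. *)
have gz : root (pZtoC g) z.
  have [hz|//] : root (pZtoC h) z \/ root (pZtoC g) z.
    apply/orP; rewrite -rootM -rmorphM -PE /= map_polyZ PhiC /root hornerZ.
    by rewrite (rootP _) ?mulr0 // root_cyclotomic.
  have [pz [Dpz _] dv] := minCpolyP z.
  have: pz %| map_poly (intr : int -> rat) h.
    rewrite -dv -map_poly_comp; rewrite (eq_map_poly (g := intr)) //.
    by move=> b /=; rewrite rmorph_int.
  move/dvdp_leq; have inj : injective (intr : int -> rat) by apply: intr_inj.
  rewrite map_poly_eq0_id0 ?intr_eq0 ?lead_coef_eq0 // => /(_ hn0).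
  rewrite size_map_inj_poly // leqNgt; case/negP; apply: leq_trans sz _.
  have <- : size (map_poly ratr pz : {poly algC}) = size pz by rewrite size_map_poly.
  rewrite -Dpz (minCpoly_cyclotomic prim_z) -PhiC.
  by rewrite size_map_inj_poly //; apply: intr_inj.
have: root (pZtoC (cf *: f)) z by rewrite fE rmorphM rootM /= gz orbT.
by rewrite map_polyZ /root hornerZ mulf_eq0 intr_eq0 (negPf cf0).
Qed.

(** With x_i written as powers zk^(e_i) of a primitive root, the sum becomes an integral relation on
    zk. It transfers to a root of unity in [algC], where equality in the triangle inequality makes
    each term 1. *)
Lemma sum_unity_roots n m (x : 'I_n -> k) : (0 < m)%N ->
  (forall i, x i ^+ m = 1) -> \sum_i x i = n%:R -> forall i, x i = 1.
Proof.
move=> m_gt0 xm sx; have [zk prim_zk] := prim_root_exists m_gt0.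
pose e i := val (sval (prim_rootP prim_zk (xm i))).
have xE i : x i = zk ^+ e i by rewrite /e; case: (prim_rootP _ _).
have : root (pZtok ('X^m - 1)) zk.
  by rewrite rmorphB rmorph1 /= map_polyXn /root !hornerE prim_expr_order ?subrr.
(* X^m - 1 is a product of cyclotomic polynomials, so zk is a root of 'Phi_d for some d dividing m;
   a primitive d-th root in [algC] will stand in for zk. *)
rewrite -prod_Cyclotomic // rmorph_prod /root horner_prod prodf_seq_eq0.
case/hasP=> d d_m /= Phizk.
have dm : (d %| m)%N by rewrite dvdn_divisors.
have d_gt0 : (0 < d)%N by apply: dvdn_gt0 dm.
have zkd : zk ^+ d = 1.
  have : root (pZtok ('X^d - 1)) zk.
    rewrite -prod_Cyclotomic // rmorph_prod /root horner_prod prodf_seq_eq0.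
    apply/hasP; exists d => //.
    by rewrite -dvdn_divisors.
  by rewrite rmorphB rmorph1 /= map_polyXn /root !hornerE subr_eq0 => /eqP.
have [z prim_z] := C_prim_root_exists d_gt0.
pose f : {poly int} := \sum_i 'X^(e i) - n%:R.
have mapf (R : nzRingType) (y : R) : (map_poly (intr : int -> R) f).[y] =
    \sum_i y ^+ e i - n%:R.
  rewrite rmorphB rmorph_nat rmorph_sum /= !hornerE horner_sum.
  rewrite hornerMn hornerC; congr (_ - _).
  by apply: eq_bigr => i _; rewrite map_polyXn hornerXn.
have fzk : root (pZtok f) zk.
  by rewrite /root mapf -(eq_bigr _ (fun i _ => xE i)) sx subrr.
have := transfer_root Phizk prim_z fzk; rewrite /root mapf subr_eq0 => /eqP sz.
have z1 : `|z| = 1.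
  apply/eqP; rewrite -(pexpr_eq1 d_gt0) ?normr_ge0 // -normrX.
  by rewrite prim_expr_order // normr1.
have ze i : z ^+ e i = 1.
  apply: (@normC_sum_upper _ 'I_n predT (fun j => z ^+ e j) (fun _ => 1) _ _ i isT).
    by move=> j _; rewrite normrX z1 expr1n.
  by rewrite sz sumr_const card_ord.
move=> i; have /eqP := ze i; rewrite -(prim_order_dvd prim_z) => /dvdnP[c ec].
by rewrite xE ec mulnC exprM zkd expr1n.
Qed.

(** B is a root of X^m - 1, which is separable in characteristic 0, so B is diagonalizable with
    roots of unity as eigenvalues; [sum_unity_roots] makes them all 1. *)
Lemma trace_finite_order n m (B : 'M[k]_n) : (0 < m)%N ->
  B ^+ m = 1%:M -> \tr B = n%:R -> B = 1%:M.
Proof.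
case: n B => [|n] B m_gt0 Bm trB; first by apply/matrixP=> -[].
have [Q Qu dQ] : exists2 Q : 'M[k]_n.+1, Q \in unitmx & similar_diag Q B.
  apply/diagonalizableP.
  have m0 : m%:R != 0 :> k by rewrite natr_eq0_char0 -lt0n.
  have [r Dp] := closed_field_poly_normal ('X^m - 1 : {poly k}).
  rewrite (monicP _) ?monicXnsubC // scale1r in Dp.
  exists r; first by rewrite -separable_prod_XsubC -Dp separable_Xn_sub_1.
  rewrite -Dp; apply: mxminpoly_min; rewrite rmorphB rmorph1 rmorphXn /=.
  by rewrite horner_mx_X; apply/eqP; rewrite subr_eq0; apply/eqP; apply: Bm.
case/(similar_diagLR Qu): dQ => D BE.
rewrite conjumx ?unitmx_inv // invmxK in BE.
have pow j : B ^+ j = invmx Q *m diag_mx (\row_i D 0 i ^+ j) *m Q.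
  elim: j => [|j IHj].
    rewrite expr0 (_ : diag_mx _ = 1%:M) ?mulmx1 ?mulVmx //.
    by apply/matrixP=> i l; rewrite !mxE expr0.
  rewrite exprS IHj {1}BE -[_ * _]/(_ *m _) !mulmxA mulmxK //.
  rewrite -(mulmxA _ (diag_mx D)) mulmx_diag; congr (_ *m diag_mx _ *m _).
  by apply/rowP=> i; rewrite !mxE exprS.
have Dm i : D 0 i ^+ m = 1.
  have: diag_mx (\row_i D 0 i ^+ m) = 1%:M.
    have := Bm; rewrite pow => /(congr1 (fun X => Q *m X *m invmx Q)).
    by rewrite !mulmxA mulmxV // mul1mx mulmxK // mulmx1 mulmxV.
  by move/matrixP/(_ i i); rewrite !mxE eqxx !mulr1n.
have trD : \sum_i D 0 i = n.+1%:R.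
  rewrite -trB BE mxtrace_mulC mulmxA mulmxV // mul1mx /mxtrace.
  by apply: eq_bigr => i _; rewrite mxE eqxx mulr1n.
have D1 := sum_unity_roots m_gt0 Dm trD.
rewrite BE (_ : diag_mx D = 1%:M) ?mulmx1 ?mulVmx //.
by apply/matrixP=> i l; rewrite !mxE D1.
Qed.

End RootsOfUnity.

(** For a rank factorization E = C R, idempotence gives R C = 1, and the trace of C R is that of R
    C. *)
Lemma mxtrace_idempotent (k : fieldType) n (E : 'M[k]_n) :
  E *m E = E -> \tr E = (\rank E)%:R.
Proof.
move=> EE; have RC : row_base E *m col_base E = 1%:M.
  have CRCR : col_base E *m (row_base E *m col_base E) *m row_base E =
      col_base E *m 1%:M *m row_base E.
    by rewrite mulmx1 mulmx_base mulmxA mulmx_base -mulmxA mulmx_base.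
  have /(row_full_inj (col_base_full E)) := row_free_inj (row_base_free E) CRCR.
  exact.
by rewrite -{1}(mulmx_base E) mxtrace_mulC RC mxtrace1.
Qed.

(** * The trace of left multiplication *)

Section RegularTrace.
Variables (k : fieldType) (H : falgType k).
Implicit Types x y : H.
Local Notation e := (vbasis {:H}).

(* Row vector convention, so that products are reversed. *)
Definition lmul_mx x : 'M[k]_(\dim {:H}) := \matrix_(i, j) coord e j (x * e`_i).

Lemma lmul_mxM x y : lmul_mx (x * y) = lmul_mx y *m lmul_mx x.
Proof.
apply/matrixP=> i j; rewrite !mxE -mulrA {1}(coord_vbasis (memvf (y * e`_i))).
rewrite mulr_sumr linear_sum; apply: eq_bigr => r _.
by rewrite !mxE -scalerAr linearZ.
Qed.

Lemma lmul_mx1 : lmul_mx 1 = 1%:M.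
Proof.
apply/matrixP=> i j; rewrite !mxE mul1r coord_free ?(basis_free (vbasisP _)) // eq_sym.
Qed.

Lemma lmul_mxX x m : lmul_mx (x ^+ m) = lmul_mx x ^+ m.
Proof.
elim: m => [|m IHm]; first by rewrite expr0 lmul_mx1.
by rewrite exprS lmul_mxM IHm exprSr.
Qed.

Lemma lmul_mx_inj x : lmul_mx x = 1%:M -> x = 1.
Proof.
move=> x1; rewrite -[x]mulr1 (coord_vbasis (memvf (1 : H))) mulr_sumr.
apply: eq_bigr => i _; rewrite -scalerAr; congr (_ *: _).
rewrite (coord_vbasis (memvf (x * e`_i))) (bigD1 i) //=.
have E j : coord e j (x * e`_i) = (i == j)%:R.
  by move/matrixP: x1 => /(_ i j); rewrite !mxE.
rewrite E eqxx scale1r big1 ?addr0 // => j /negPf ji.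
by rewrite E eq_sym ji scale0r.
Qed.

Definition regtr x : k := \tr (lmul_mx x).

Lemma regtr_is_linear : scalar regtr.
Proof.
move=> a x y; rewrite /regtr -mxtraceZ -mxtraceD; congr (\tr _).
by apply/matrixP=> i j; rewrite !mxE mulrDl -scalerAl linearP.
Qed.

HB.instance Definition _ := GRing.isLinear.Build k H k *%R regtr regtr_is_linear.

Lemma regtrC x y : regtr (x * y) = regtr (y * x).
Proof. by rewrite /regtr !lmul_mxM mxtrace_mulC. Qed.

Lemma regtr1 : regtr 1 = (\dim {:H})%:R.
Proof. by rewrite /regtr lmul_mx1 mxtrace1. Qed.

End RegularTrace.

(** * The action of G on P_1 and its trace *)

Section Divisibility.
Variables (k : closedFieldType) (H : falgType k) (A : hopf_algebra H).
Variable p : 'End(H).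
Hypothesis char0 : [pchar k] =i pred0.
Hypothesis p_proj : coalg_projection A (coradical A) p.
Implicit Types (a b : 'Hom(H, k^o)) (x y g h : H).
Local Notation S := (antipode A).
Local Notation q := (\1 - p)%VF.
Local Notation P := (P1 A p).
Local Notation X := (vbasis P).

(** Coordinates are stored in columns here, so products keep their order, unlike in [lmul_mx]. *)
Definition act_mx g : 'M[k]_(\dim P) :=
  \matrix_(i, j) coord X i (q (amull g X`_j)).

Let XP (j : 'I_(\dim P)) : X`_j \in P.
Proof. by apply/vbasis_mem/mem_nth; rewrite size_tuple. Qed.

Lemma act_mxE g (j : 'I_(\dim P)) : grouplike A g ->
  q (amull g X`_j) = \sum_(i < \dim P) act_mx g i j *: X`_i.
Proof.
move=> gg; rewrite {1}(coord_vbasis (translate_P1 p_proj gg (XP j))).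
by apply: eq_bigr => i _; rewrite mxE.
Qed.

(** q(g q(h x)) = q(g h x), because g p(h x) lies in H_0, which q kills. *)
Lemma act_mxM g h : grouplike A g -> grouplike A h ->
  act_mx (g * h) = act_mx g *m act_mx h.
Proof.
move=> gg gh; apply/matrixP=> i j; rewrite [LHS]mxE [RHS]mxE.
have -> : q (amull (g * h) X`_j) = q (amull g (q (amull h X`_j))).
  rewrite [q (amull h _)]qE linearB linearB /=.
  have /(proj_id p_proj) gp : amull g (p (amull h X`_j)) \in coradical A.
    by rewrite translate_H0 //; apply: proj_in.
  by rewrite [q (amull g (p _))]qE gp subrr subr0 !lfunE /= mulrA.
rewrite (act_mxE j gh) !linear_sum; apply: eq_bigr => r _.
by rewrite !linearZ /= mulrC; congr (_ * _); rewrite mxE.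
Qed.

Lemma act_mx1 : act_mx 1 = 1%:M.
Proof.
apply/matrixP=> i j; rewrite !mxE qE [amull _ _]lfunE /= mul1r.
rewrite (P1_proj p_proj (XP j)) subr0.
by rewrite coord_free ?(basis_free (vbasisP _)) // eq_sym.
Qed.

Local Notation c := (@coef_mx _ _ A p P).

(** If ρ_R(x) is the sum of the x_0 ⊗ x_1, then ρ_R(q(g x)) is the sum of the q(g x_0) ⊗ g x_1. For
    x the l-th basis vector, both sides are the coefficient of the i-th basis vector in the first
    factor. *)
Lemma act_coef g i l : grouplike A g ->
  \sum_j act_mx g j l *: c i j = \sum_j act_mx g i j *: (g * c j l).
Proof.
move=> gg; apply: functional_ext => b; rewrite !linear_sum.
pose xi : 'Hom(H, k^o) := linfun (coord X i : H -> k^o).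
have xiE x : coord X i x = xi x by rewrite lfunE.
transitivity (xi (ract A (b \o p)%VF (q (amull g X`_l)))).
  rewrite (act_mxE l gg) !linear_sum; apply: eq_bigr => j _.
  by rewrite !linearZ /= coef_mxP xiE.
pose y := ract A ((b \o amull g) \o p)%VF X`_l.
have yP : y \in P by apply: P1_ract.
transitivity (xi (q (amull g y))); last first.
  rewrite (coord_vbasis yP) !linear_sum; apply: eq_bigr => j _.
  rewrite !linearZ /= -[b _]/(b (g * c j l)) mxE xiE.
  have -> : b (g * c j l) = (b \o amull g)%VF (c j l).
    by rewrite comp_lfunE lfunE.
  by rewrite coef_mxP [LHS]mulrC.
rewrite -conv_ract (q_conv_r p_proj) conv_translate //.
rewrite (P1_conv_vanishl p_proj) //; last first.
  by apply: vanish_comp (vanishq p_proj _); apply: translate_H0.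
have -> : (((b \o p) \o amull g) \o p)%VF = ((b \o amull g) \o p)%VF.
  apply/lfunP=> z; rewrite !comp_lfunE; congr (b _); apply: (proj_id p_proj).
  by rewrite translate_H0 //; apply: proj_in.
by rewrite conv_ract -/y comp_lfunE comp_lfunE.
Qed.

Lemma coefP : comatrix A c.
Proof.
apply: coef_comatrix; first by case: p_proj.
by move=> a x; apply: P1_ract.
Qed.

(* Both sides evaluate the trace of c * act_mx g * S(c), where c is the
   comatrix of P1, using S(c) = c^-1 and c * act_mx g = g * act_mx g * c. *)
Lemma act_mx_trace g : grouplike A g ->
  \tr (act_mx g) * regtr (1 : H) = \tr (act_mx g) * regtr g.
Proof.
move=> gg; have cP := coefP.
transitivity (\sum_i \sum_l regtr ((\sum_j act_mx g j l *: c i j) * S (c l i))).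
  (* Cyclicity of [regtr] brings S(c) to the left of c, where the two cancel. *)
  transitivity (\sum_j \sum_l act_mx g j l *
                  \sum_i regtr (S (c l i) * c i j)).
    rewrite mulr_suml; apply: eq_bigr => j _; rewrite (bigD1 j) //=.
    rewrite -linear_sum comatrix_antipodel // eqxx scale1r.
    rewrite big1 ?addr0 // => l /negPf lj.
    by rewrite -linear_sum comatrix_antipodel // lj scale0r linear0 mulr0.
  under eq_bigr => j _ do under eq_bigr => l _ do rewrite mulr_sumr.
  under eq_bigr => j _ do rewrite exchange_big.
  rewrite exchange_big; apply: eq_bigr => i _ /=.
  rewrite exchange_big; apply: eq_bigr => l _ /=.
  rewrite mulr_suml linear_sum; apply: eq_bigr => j _ /=.
  by rewrite -scalerAl linearZ /= regtrC.
transitivity (\sum_i \sum_l regtr ((\sum_j act_mx g i j *: (g * c j l)) * S (c l i))).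
  by apply: eq_bigr => i _; apply: eq_bigr => l _; rewrite act_coef.
transitivity (\sum_i \sum_j act_mx g i j *
                regtr (g * \sum_l c j l * S (c l i))).
  apply: eq_bigr => i _.
  under eq_bigr => l _ do rewrite mulr_suml linear_sum.
  rewrite exchange_big; apply: eq_bigr => j _ /=.
  rewrite [g * _]mulr_sumr (linear_sum (@regtr k H)) mulr_sumr; apply: eq_bigr => l _ /=.
  by rewrite -scalerAl linearZ /= mulrA.
rewrite mulr_suml; apply: eq_bigr => i _; rewrite (bigD1 i) //=.
rewrite comatrix_antipoder // eqxx scale1r mulr1.
rewrite big1 ?addr0 // => j /negPf ji.
by rewrite comatrix_antipoder // ji scale0r mulr0 linear0 mulr0.
Qed.

Local Notation G := (grouplikes A).

Lemma grouplike_exp g m : grouplike A g -> grouplike A (g ^+ m).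
Proof.
move=> gg; elim: m => [|m IHm]; first exact: grouplike1.
by rewrite exprS grouplike_mul.
Qed.

Lemma grouplike_finite_order g : grouplike A g ->
  exists2 m, (0 < m)%N & g ^+ m = 1.
Proof.
move=> gg.
have [i [j [ij fij]]] : exists i j : nat, (i < j)%N /\ g ^+ i = g ^+ j.
  apply: contrapT => no.
  have: uniq [seq g ^+ i | i <- iota 0 (#|` G|).+1].
    rewrite map_inj_in_uniq ?iota_uniq // => i j _ _ eij.
    by have [ij|ji|//] := ltngtP i j; case: no; [exists i, j | exists j, i].
  move/uniq_leq_size=> /(_ (G : seq H)).
  rewrite size_map size_iota ltnn => /(_ _)/negP[] //.
  by move=> _ /mapP[i _ ->]; rewrite in_grouplikes grouplike_exp.
exists (j - i)%N; first by rewrite subn_gt0.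
have gi := grouplike_exp i gg.
rewrite -[LHS]mul1r -(grouplike_mulVl gi) -mulrA -exprD subnKC ?(ltnW ij) //.
by rewrite -fij grouplike_mulVl.
Qed.

(** Cancelling a nonzero trace in [act_mx_trace] would leave [regtr g] = dim H; as g has finite
    order, left multiplication by g would be the identity. *)
Lemma act_mx_trace0 g : grouplike A g -> g != 1 -> \tr (act_mx g) = 0.
Proof.
move=> gg; apply: contra_neq_eq => tr0.
apply: lmul_mx_inj; have [m m_gt0 gm] := grouplike_finite_order gg.
apply: (trace_finite_order char0 m_gt0); first by rewrite -lmul_mxX gm lmul_mx1.
by rewrite -[LHS]/(regtr g) -regtr1; apply/esym/(mulfI tr0)/act_mx_trace.
Qed.

Lemma grouplikes_dvd_P1 : (#|` G| %| \dim P)%N.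
Proof.
pose N := #|` G|; pose E := \sum_(g <- G) act_mx g.
have GP g : g \in (G : seq H) -> grouplike A g by rewrite -in_grouplikes.
have trE : \tr E = (\dim P)%:R.
  have G1 : 1 \in (G : seq H).
    have: 1 \in G by rewrite in_grouplikes grouplike1.
    by [].
  rewrite /E raddf_sum (bigD1_seq 1) ?fset_uniq //= act_mx1 mxtrace1.
  rewrite big_seq_cond big1 ?addr0 // => g /andP[/GP gg g1].
  exact: act_mx_trace0.
have gE g : g \in (G : seq H) -> act_mx g *m E = E.
  move=> /GP gg; rewrite /E mulmx_sumr.
  have inj : injective (fun x => g * x).
    by move=> x y /(congr1 (fun z => S g * z)); rewrite !mulrA grouplike_mulVl // !mul1r.
  have pG : perm_eq [seq g * x | x <- G] G.
    have ugG : uniq [seq g * x | x <- G] by rewrite map_inj_uniq ?fset_uniq.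
    apply: uniq_perm => //; first exact: fset_uniq.
    apply: (uniq_min_size ugG _ _).2; last by rewrite size_map.
    move=> _ /mapP[x /GP xG ->].
    have: g * x \in G by rewrite in_grouplikes grouplike_mul.
    by [].
  rewrite -[RHS](perm_big _ pG) big_map; apply: eq_big_seq => h /GP gh.
  by rewrite act_mxM.
have N0 : N%:R != 0 :> k.
  rewrite natr_eq0_char0 // -lt0n cardfs_gt0; apply/fset0Pn; exists 1.
  by rewrite in_grouplikes grouplike1.
(* The averaging idempotent. Its trace dim P_1 / N is its rank, and characteristic 0 turns this
   equation in k into one between natural numbers. *)
pose F := N%:R^-1 *: E.
have EE : E *m E = N%:R *: E.
  rewrite {1}/E mulmx_suml (eq_big_seq (fun _ => E)) //.
  by rewrite big_const_seq count_predT iter_addr addr0 scaler_nat.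
have FF : F *m F = F.
  by rewrite /F -scalemxAl -scalemxAr EE (scalerA _ N%:R) mulVf // scale1r.
have := mxtrace_idempotent FF; rewrite /F mxtraceZ trE => rk.
have : ((\dim P)%:R : k) = (N * \rank F)%:R.
  by rewrite natrM /F -rk mulrA mulfV // mul1r.
by move/(natr_inj_char0 char0) => ->; apply: dvdn_mulr.
Qed.

End Divisibility.

(** * Matrix units of the coradical *)

Section DualSystemGrouplike.
Variables (k : fieldType) (T : finType).
Local Notation C := (glspace k T).

Definition glcoef (t : T) (f : C) : k^o := f t.

Lemma glcoef_is_linear t : linear (glcoef t).
Proof. by move=> a f g; rewrite /glcoef !ffunE. Qed.

HB.instance Definition _ t :=
  GRing.isLinear.Build k C k^o _ (glcoef t) (glcoef_is_linear t).

Lemma dual_system_gl m : exists Om N d om,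
  dual_system (glcoalg k T) \1%VF (@glelt k T) Om N d om m.
Proof.
pose Om t : 'Hom(C, k^o) := linfun (glcoef t).
have OmE t t' : Om t (@glelt k T t') = (t == t')%:R.
  by rewrite lfunE /= /glcoef ffunE.
have glD t : comul (glcoalg k T) (@glelt k T t) = @glelt k T t ⊗ @glelt k T t.
  by rewrite /= lfunE /= glcomulE.
exists Om, 0%N, (fun _ => 0%N), (fun _ _ _ => 0); split=> //.
- by move=> t; rewrite /grouplike glD /= glcounitE !eqxx.
- move=> t; split=> [|a|a]; first by rewrite comp_lfun1r.
    apply/lfunP; apply: glcoalg_ext => s /=; rewrite comp_lfun1r scale_lfunE convE.
    rewrite glD tpairE OmE; have [->//|_] := eqVneq t s.
    by rewrite mulr0 scaler0.
  apply/lfunP; apply: glcoalg_ext => s /=; rewrite comp_lfun1r scale_lfunE convE.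
  rewrite glD tpairE OmE; have [->|_] := eqVneq t s; first by rewrite [LHS]mulrC.
  by rewrite mul0r scaler0.
rewrite big_ord0 addr0; apply/lfunP; apply: glcoalg_ext => s /=.
rewrite epsE /= glcounitE sum_lfunE (bigD1 s) //= OmE eqxx.
by rewrite big1 ?addr0 // => t /negPf ts; rewrite OmE ts.
Qed.

End DualSystemGrouplike.

Section MatrixUnits.
Variables (k : fieldType) (n : nat).
Local Notation C := (mxspace k n.+1).

(** Natural number indices fit [dual_system], whose blocks vary in size. An index out of range is
    read as 0, whence the bounds in [mxunit_conv]. *)
Definition mxcoef (i j : nat) (M : C) : k^o := M (inord i) (inord j).

Lemma mxcoef_is_linear i j : linear (mxcoef i j).
Proof. by move=> a M N; rewrite /mxcoef !mxE. Qed.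

HB.instance Definition _ i j :=
  GRing.isLinear.Build k C k^o _ (mxcoef i j) (mxcoef_is_linear i j).

Definition mxunit i j : 'Hom(C, k^o) := linfun (mxcoef i j).

Lemma mxunitE i j (r s : 'I_n.+1) :
  mxunit i j (delta_mx r s : C) = ((inord i == r) && (inord j == s))%:R.
Proof. by rewrite lfunE /= /mxcoef mxE. Qed.

Lemma mxunit_conv i j i' j' : (j < n.+1)%N -> (i' < n.+1)%N ->
  conv (matcoalg k n.+1) (mxunit i j) (mxunit i' j') = (j == i')%:R *: mxunit i j'.
Proof.
move=> jn in'; apply/lfunP; apply: matcoalg_ext => r s /=.
rewrite scale_lfunE convE /= [linfun _ _]lfunE /= mxcomulE linear_sum.
have jjE : (inord j == inord i' :> 'I_n.+1) = (j == i').
  by rewrite -(inj_eq val_inj) /= !inordK.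
rewrite (bigD1 (inord j)) //= tpairE !mxunitE eqxx andbT [inord i' == _]eq_sym jjE.
rewrite big1 ?addr0 => [|l lj]; last first.
  by rewrite tpairE !mxunitE [inord j == l]eq_sym (negPf lj) andbF mul0r.
by rewrite -[_ *: _]/(_ * _) -!natrM !mulnb andbCA.
Qed.

Lemma mxunit_eps : eps (matcoalg k n.+1) = \sum_(i < n.+1) mxunit i i.
Proof.
apply/lfunP; apply: matcoalg_ext => r s /=; rewrite epsE /= mxcounitE sum_lfunE.
rewrite (bigD1 r) //= mxunitE !inord_val eqxx /= big1 ?addr0 // => l lr.
by rewrite mxunitE inord_val (negPf lr).
Qed.

End MatrixUnits.

(** * Dual systems of direct sums *)

Section DualSystemSum.
Variables (k : fieldType) (V W : vectType k) (c : coalgebra V) (d : coalgebra W).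
Local Notation E := (dsum_space V W).

Definition dsum_fst (z : E) : V := z.1.
Definition dsum_snd (z : E) : W := z.2.

Lemma dsum_fst_linear : linear dsum_fst. Proof. by []. Qed.
Lemma dsum_snd_linear : linear dsum_snd. Proof. by []. Qed.

HB.instance Definition _ := GRing.isLinear.Build k E V _ dsum_fst dsum_fst_linear.
HB.instance Definition _ := GRing.isLinear.Build k E W _ dsum_snd dsum_snd_linear.

Definition fst_lfun : 'Hom(E, V) := linfun dsum_fst.
Definition snd_lfun : 'Hom(E, W) := linfun dsum_snd.

Lemma dsum_convE (a b : 'Hom(E, k^o)) (z : E) : conv (dsum c d) a b z =
  conv c (a \o inl_lfun V W)%VF (b \o inl_lfun V W)%VF z.1 +
  conv d (a \o inr_lfun V W)%VF (b \o inr_lfun V W)%VF z.2.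
Proof.
by rewrite convE /= [linfun _ _]lfunE /= /dsum_comul linearD /= !tpair_tmap !convE.
Qed.

Lemma fst_inl (U : vectType k) (a : 'Hom(V, U)) :
  ((a \o fst_lfun) \o inl_lfun V W)%VF = a.
Proof. by apply/lfunP=> x; rewrite !comp_lfunE !lfunE. Qed.

Lemma fst_inr (U : vectType k) (a : 'Hom(V, U)) :
  ((a \o fst_lfun) \o inr_lfun V W)%VF = 0.
Proof. by apply/lfunP=> x; rewrite !comp_lfunE !lfunE /= linear0. Qed.

Lemma snd_inl (U : vectType k) (a : 'Hom(W, U)) :
  ((a \o snd_lfun) \o inl_lfun V W)%VF = 0.
Proof. by apply/lfunP=> x; rewrite !comp_lfunE !lfunE /= linear0. Qed.

Lemma snd_inr (U : vectType k) (a : 'Hom(W, U)) :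
  ((a \o snd_lfun) \o inr_lfun V W)%VF = a.
Proof. by apply/lfunP=> x; rewrite !comp_lfunE !lfunE. Qed.

Lemma conv0l (U : vectType k) (e : coalgebra U) (a : 'Hom(U, k^o)) :
  conv e 0 a = 0.
Proof. by apply/lfunP=> x; rewrite convE tpair_liftr !zero_lfunE. Qed.

Lemma conv0r (U : vectType k) (e : coalgebra U) (a : 'Hom(U, k^o)) :
  conv e a 0 = 0.
Proof. by apply/lfunP=> x; rewrite convE tpair_lift !zero_lfunE. Qed.

End DualSystemSum.

Lemma dual_system_dsum (k : fieldType) (V : vectType k) (c : coalgebra V)
    (T : finType) m n :
  (0 < m)%N -> (m <= n)%N ->
  (exists phi Om N d om, @dual_system _ _ c \1%VF T phi Om N d om m) ->
  exists phi Om N d om,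
    @dual_system _ _ (dsum c (matcoalg k n)) \1%VF T phi Om N d om m.
Proof.
case: n => [|n] m_gt0; first by rewrite leqNgt m_gt0.
move=> mn [phi [Om [N [d [om [phiG Omphi Omc omc epsE']]]]]].
set W := mxspace k n.+1.
exists (fun t => inl_lfun V W (phi t)), (fun t => Om t \o fst_lfun V W)%VF, N.+1.
(* The new matrix block gets index N. All functionals are extended by zero on the other summand. *)
exists (fun s => if s == N then n.+1 else d s).
exists (fun s i j => if s == N then (mxunit k n i j \o snd_lfun V W)%VF
                     else (om s i j \o fst_lfun V W)%VF).
have conv_fst a b : conv (dsum c (matcoalg k n.+1)) (a \o fst_lfun V W)%VF
    (b \o fst_lfun V W)%VF = (conv c a b \o fst_lfun V W)%VF.
  apply/lfunP=> z; rewrite dsum_convE !fst_inl !fst_inr conv0l zero_lfunE addr0.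
  by rewrite [RHS]comp_lfunE [fst_lfun V W z]lfunE.
have conv_snd a b : conv (dsum c (matcoalg k n.+1)) (a \o snd_lfun V W)%VF
    (b \o snd_lfun V W)%VF = (conv (matcoalg k n.+1) a b \o snd_lfun V W)%VF.
  apply/lfunP=> z; rewrite dsum_convE !snd_inl !snd_inr conv0l zero_lfunE add0r.
  by rewrite [RHS]comp_lfunE [snd_lfun V W z]lfunE.
have scale_comp (U U' : vectType k) r (a : 'Hom(U', k^o)) (b : 'Hom(U, U')) :
    (r *: a \o b)%VF = r *: (a \o b)%VF by rewrite comp_lfunZl.
split.
- move=> t; have /andP[/eqP gD /eqP ge] := phiG t.
  rewrite /grouplike /= [linfun _ _]lfunE /= /dsum_comul /dsum_counit.
  by rewrite [inl_lfun V W _]lfunE /= !linear0 !addr0 ge gD tmapE lfunE /= !eqxx.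
- by move=> t t'; rewrite -comp_lfunE fst_inl.
- move=> t; have [_ Ol Or] := Omc t.
  split=> [|a|a]; first by rewrite comp_lfun1r.
    apply/lfunP=> z; rewrite comp_lfun1r dsum_convE fst_inl fst_inr conv0r.
    rewrite zero_lfunE addr0 -[X in conv c X]comp_lfun1r Ol !scale_lfunE !comp_lfunE.
    by rewrite [fst_lfun V W z]lfunE.
  apply/lfunP=> z; rewrite comp_lfun1r dsum_convE fst_inl fst_inr conv0l.
  rewrite zero_lfunE addr0 -[X in conv c _ X]comp_lfun1r Or !scale_lfunE !comp_lfunE.
  by rewrite [fst_lfun V W z]lfunE.
- move=> s; rewrite ltnS leq_eqVlt; have [-> _|sN /= /omc[ms _ oc]] := eqVneq s N.
    split=> // [i j|i j i' j' _ jn in' _]; first by rewrite comp_lfun1r.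
    by rewrite conv_snd mxunit_conv // scale_comp.
  split=> // [i j|i j i' j' id jd id' jd']; first by rewrite comp_lfun1r.
  by rewrite conv_fst oc // scale_comp.
have -> : eps (dsum c (matcoalg k n.+1)) =
    (eps c \o fst_lfun V W)%VF + (eps (matcoalg k n.+1) \o snd_lfun V W)%VF.
  apply/lfunP=> z; rewrite add_lfunE !comp_lfunE !epsE /= /dsum_counit.
  by rewrite [fst_lfun V W z]lfunE [snd_lfun V W z]lfunE.
have sum_comp (U U' : vectType k) I (r : seq I) (P : pred I)
    (a : I -> 'Hom(U', k^o)) (b : 'Hom(U, U')) :
    ((\sum_(i <- r | P i) a i) \o b)%VF = \sum_(i <- r | P i) (a i \o b)%VF.
  apply/lfunP=> x; rewrite comp_lfunE !sum_lfunE.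
  by apply: eq_bigr => i _; rewrite comp_lfunE.
rewrite epsE' mxunit_eps comp_lfunDl !sum_comp -addrA; congr (_ + _).
rewrite [RHS]big_ord_recr /= eqxx; congr (_ + _).
apply: eq_bigr => s _; rewrite sum_comp.
by rewrite (ltn_eqF (ltn_ord s)).
Qed.

Lemma dual_system_dsum_mx (k : fieldType) (V : vectType k) (c : coalgebra V)
    (T : finType) m (ns : seq nat) :
  (0 < m)%N -> all (leq m) ns ->
  (exists phi Om N d om, @dual_system _ _ c \1%VF T phi Om N d om m) ->
  exists phi Om N d om, @dual_system _ _ (dsum_mx c ns) \1%VF T phi Om N d om m.
Proof.
move=> m_gt0; elim: ns => [//|n ns IHns] /= in V c * => /andP[mn mns] sysc.
exact/IHns/dual_system_dsum.
Qed.

Lemma dual_system_iso (k : fieldType) (V W : vectType k) (c : coalgebra V)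
    (d : coalgebra W) (p : 'End(W)) (T : finType) m :
  coalg_projection d (coradical d) p -> subcoalg_iso d (coradical d) c ->
  (exists phi Om N e om, @dual_system _ _ c \1%VF T phi Om N e om m) ->
  exists phi Om N e om, @dual_system _ _ d p T phi Om N e om m.
Proof.
move=> p_proj [f [[fD fe] fK fH]] [phi [Om [N [e [om [phiG Omphi Omc omc epsE']]]]]].
have f_inj : lker f == 0%VS by rewrite fK.
(* A retraction of f with f ∘ th = p. Composition with [th] embeds the dual algebra of V in that of
   W, with the functionals a ∘ p as image. *)
pose th : 'Hom(W, V) := (f^-1 \o p)%VF.
have fth : (f \o th)%VF = p.
  apply/lfunP=> x; rewrite !comp_lfunE limg_lfunVK // fH.
  exact: (proj_in p_proj).
have thf y : th (f y) = y.
  rewrite comp_lfunE (proj_id p_proj) ?lker0_lfunK // -fH.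
  by rewrite memv_img ?memvf.
have thp : (th \o p)%VF = th.
  by apply/lfunP=> x; rewrite !comp_lfunE (projK p_proj).
have conv_th a b : conv d (a \o th)%VF (b \o th)%VF = (conv c a b \o th)%VF.
  have aE (a' : 'Hom(V, k^o)) : a' = ((a' \o th) \o f)%VF.
    by apply/lfunP=> y; rewrite !comp_lfunE -[f^-1%VF _]comp_lfunE thf.
  have pE (a' : 'Hom(V, k^o)) : ((a' \o th) \o p)%VF = (a' \o th)%VF.
    by rewrite -comp_lfunA thp.
  rewrite -{1}(pE a) -{1}(pE b) (proj_conv p_proj) -fth.
  apply/lfunP=> x; rewrite [LHS]comp_lfunE [RHS]comp_lfunE [LHS]convE.
  by rewrite [(f \o th)%VF x]comp_lfunE fD tpair_tmap -!aE -convE.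
exists (fun t => f (phi t)), (fun t => Om t \o th)%VF, N, e.
exists (fun s i j => om s i j \o th)%VF; split.
- move=> t; have /andP[/eqP gD /eqP ge] := phiG t.
  by rewrite /grouplike fD fe ge gD tmapE !eqxx.
- by move=> t t'; rewrite comp_lfunE thf.
- move=> t; have [_ Ol Or] := Omc t; split=> [|a|a]; first by rewrite -comp_lfunA thp.
    rewrite -fth comp_lfunA conv_th -[X in conv c X]comp_lfun1r Ol comp_lfunZl.
    by rewrite comp_lfunE.
  rewrite -fth comp_lfunA conv_th -[X in conv c _ X]comp_lfun1r Or comp_lfunZl.
  by rewrite comp_lfunE.
- move=> s /omc[ms _ oc]; split=> // [i j|*]; first by rewrite -comp_lfunA thp.
  by rewrite conv_th oc // comp_lfunZl.
have -> : eps d = (eps c \o th)%VF.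
  rewrite -(proj_eps p_proj) -fth comp_lfunA; congr (_ \o _)%VF.
  by apply/lfunP=> x; rewrite comp_lfunE !epsE fe.
have sum_comp I (r : seq I) (P : pred I) (a : I -> 'Hom(V, k^o)) :
    ((\sum_(i <- r | P i) a i) \o th)%VF = \sum_(i <- r | P i) (a i \o th)%VF.
  apply/lfunP=> x; rewrite comp_lfunE !sum_lfunE.
  by apply: eq_bigr => i _; rewrite comp_lfunE.
rewrite epsE' comp_lfunDl !sum_comp; congr (_ + _).
by apply: eq_bigr => s _; rewrite sum_comp.
Qed.

Theorem proposition4p2 (k : closedFieldType) (char0 : [pchar k] =i pred0)
    (H : falgType k) (A : hopf_algebra H)
    (noncosemisimple : ~ cosemisimple A)
    (no_skew : ~ exists x : H, nontrivial_skew_primitive A x)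
    (t : nat) (n : t.-tuple nat) (t_ge1 : (1 <= t)%N)
    (n1_ge2 : (2 <= nth 0 n 0)%N) (n_sorted : sorted leq n)
    (H0_iso : subcoalg_iso A (coradical A)
                (dsum_mx (glcoalg k (grouplikes A)) n))
    (p : 'End(H)) (p_proj : coalg_projection A (coradical A) p) :
  (#|` grouplikes A| %| \dim (P1 A p))%N /\
  (minn (nth 0 n 0 ^ 2) (2 * nth 0 n 0 * #|` grouplikes A|)
     <= \dim (P1 A p))%N.
Proof.
split; first exact: grouplikes_dvd_P1.
have n1_gt0 : (0 < nth 0%N n 0)%N by apply: leq_trans n1_ge2.
(* Sortedness makes the first entry a lower bound for all block sizes, as [dual_system] asks of
   m. *)
have n1_min : all (leq (nth 0%N n 0)) n.
  case: n n_sorted {H0_iso n1_ge2 n1_gt0} => -[//|n1 ns] /= _ n_path.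
  by rewrite leqnn /=; apply: order_path_min n_path; apply: leq_trans.
have [Om0 [N0 [d0 [om0 sys0]]]] := dual_system_gl k (grouplikes A) (nth 0%N n 0).
have [|phi [Om [N [d [om sys]]]]] :=
  dual_system_iso p_proj H0_iso (m := nth 0%N n 0) (T := grouplikes A).
  apply: dual_system_dsum_mx => //.
  by exists (@glelt k (grouplikes A)), Om0, N0, d0, om0.
have := P1_bound p_proj no_skew sys (P1_nonzero p_proj noncosemisimple).
by rewrite -cardfE.
Qed.
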